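(* Let $d\ge 3$ be a fixed integer. Then, as $n\to\infty$, $$d-\rho(n,d)=(c_d+o(1))\frac{\pi^2}{4n^2},$$ where $c_d=d-1$ if $d$ is odd and $c_d=2(d-2)$ if $d$ is even.
   Context: All graphs are finite, simple and undirected. For $d\ge 3$ and $n\ge d+1$, $\rho(n,d)$ denotes the largest adjacency spectral radius (largest eigenvalue of the adjacency matrix) among connected nonregular graphs of order $n$ and maximum degree $d$. *)

(* Defs.v *)
From HB Require Import structures.
From mathcomp Require Import all_boot all_order all_algebra.
From mathcomp Require Import all_classical all_reals all_analysis.

Set Implicit Arguments.
Unset Strict Implicit.
Unset Printing Implicit Defensive.

Import Order.TTheory GRing.Theory Num.Theory.
Import numFieldNormedType.Exports.

Local Open Scope classical_set_scope.
Local Open Scope ring_scope.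

(* A graph of order n is a relation on 'I_n; every graph of order n is
   isomorphic to one of these. *)
Definition simple_graph (n : nat) (e : rel 'I_n) : Prop :=
  symmetric e /\ irreflexive e.

Definition connected_graph (n : nat) (e : rel 'I_n) : Prop :=
  forall x y : 'I_n, connect e x y.

Definition degree (n : nat) (e : rel 'I_n) (x : 'I_n) : nat :=
  #|[pred y | e x y]|.

Definition max_degree (n : nat) (e : rel 'I_n) : nat :=
  (\max_(x < n) degree e x)%N.

Definition regular_graph (n : nat) (e : rel 'I_n) : Prop :=
  exists k : nat, forall x : 'I_n, degree e x = k.

Definition adjacency_matrix (R : realType) (n : nat) (e : rel 'I_n) : 'M[R]_n :=
  \matrix_(i < n, j < n) (e i j)%:R.

(* The set of eigenvalues is finite, and nonempty for n > 0 since the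
   matrix is real symmetric, so that this supremum is a maximum. *)
Definition spectral_radius (R : realType) (n : nat) (e : rel 'I_n) : R :=
  sup [set a : R | eigenvalue (adjacency_matrix R e) a].

Definition nonregular_family (n d : nat) : set (rel 'I_n) :=
  [set e | [/\ simple_graph e, connected_graph e, ~ regular_graph e
             & max_degree e = d]].

(* There are finitely many graphs on 'I_n, and the family is nonempty when
   3 <= d < n, so that this supremum is a maximum in that range. *)
Definition rho (R : realType) (n d : nat) : R :=
  sup [set spectral_radius R e | e in @nonregular_family n d].

Definition c_ (R : realType) (d : nat) : R :=
  if odd d then d%:R - 1 else 2 * (d%:R - 2).

(* Main.v *)
(* Lower bound on d - a for an eigenvalue a.  Let y >= 0 be the vector of absolute
   values of an eigenvector; then (d I - A) y <= (d - a) y.  List the vertices by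
   increasing y, x_0 <= x_1 <= ..., call "gap i" the place between positions i - 1 and i,
   and let X(i, j) be the number of edges joining a position below i to a position at or
   above j.  Summing the inequality
   over the positions b >= i, for i above the last vertex of degree < d, gives
     sum_j (x_j - x_{j-1}) X(min(i, j), max(i, j)) <= (d - a) sum_{b >= i} x_b.
   Since a vertex has d neighbours, small cuts X(i, i) cannot be too close to each other,
   and one can find weights W_i on the gaps, of mean 1 in the long run, for which every
   gap j satisfies sum_i W_i X(min(i, j), max(i, j)) >= c_d.  So x satisfies on average
   the inequality -c_d x'' <= (d - a) x on an interval of length at most n, and testing
   it against a cosine bounds d - a from below by c_d (2 sin(pi / (4 (n + C))))^2.

   Upper bound on d - rho.  Put p = 1 for odd d and p = 2 for even d, so that
   c_d = p (d - p).  Join about n / (d + 1) blocks of d + 1 vertices in a chain, where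
   consecutive blocks are connected by p edges, close the chain with a cap, and attach a
   path with at most d + 1 vertices at the other end.  Each block acts as a resistance
   (d + 1) / (p (d - p)), and the Rayleigh quotient of the vector that follows a quarter
   of a sine wave along the chain is d - c_d (pi / (2 n))^2 up to lower order terms. *)

Require Import Defs.
From mathcomp Require Import all_boot all_order all_algebra.
From mathcomp Require Import all_classical all_reals all_analysis.
From mathcomp Require Import zify lra.

Set Implicit Arguments.
Unset Strict Implicit.
Unset Printing Implicit Defensive.

Import Order.TTheory GRing.Theory Num.Theory.
Import numFieldNormedType.Exports.

(** * Weights on the gaps *)

(** With all [W_i] equal to 1, the sum at gap [j] is the total length of the edges across it, and a
    bridge between neighbouring positions gives only 1 where [c_d] is required. So the weights have
    to be uneven: a small cut takes weight from gaps behind it, where the degree condition forces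
    many crossing edges. The least possible cut is a matter of parity: above the last vertex of
    degree below [d], all cuts are even if [d] is even, hence the choice of [p]. The weights follow
    the positions of the small cuts, and all errors that they cause are shifts by a number [D] of
    places that depends on [d] alone; in the end these only replace [n] by [n + C]. The vertices
    before the last one of degree below [d] are arbitrary, but [y] is small there: the value at that
    last vertex is at most [d - a] times the sum of all values, and the values before it are no
    larger. *)

Section Tiling.
Variables (tile : nat -> seq nat) (L D : nat).
Hypothesis tile_gt0 : forall s, 0 < size (tile s).
Hypothesis tile_le : forall s, size (tile s) <= D.
Hypothesis tile_sum : forall s, sumn (tile s) = size (tile s).

(** The length of a tile depends on the cuts near its start, so the starts are only known
    recursively from [L]. *)
Inductive tile_start : nat -> Prop :=
| tile_start0 : tile_start L
| tile_startS s : tile_start s -> tile_start (s + size (tile s)).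

Fixpoint locate fuel s j :=
  if fuel is f.+1 then
    if j < s + size (tile s) then s else locate f (s + size (tile s)) j
  else s.

Definition weight j :=
  if j < L then 0 else let s := locate j.+1 L j in nth 0 (tile s) (j - s).

Lemma tile_start_ge s : tile_start s -> L <= s.
Proof. by elim=> // t _ ?; lia. Qed.

Lemma locate_start fuel s j : j < s + fuel -> s <= j -> tile_start s ->
  tile_start (locate fuel s j) /\
  locate fuel s j <= j < locate fuel s j + size (tile (locate fuel s j)).
Proof.
elim: fuel s => [|f IH] s /= js sj rs; first by lia.
case: ifP => [lt|ge]; first by split=> //; lia.
by apply: IH; [have := tile_gt0 s; lia | lia | exact: tile_startS].
Qed.

Lemma tile_cover j : L <= j ->
  exists s o, [/\ tile_start s, j = s + o & o < size (tile s)].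
Proof.
move=> Lj; have jL : j < L + j.+1 by lia.
have [st /andP[le lt]] := locate_start jL Lj tile_start0.
by exists (locate j.+1 L j), (j - locate j.+1 L j); split=> //; lia.
Qed.

(** The search from [L] passes through every tile start up to [j], and each tile that it skips is
    nonempty, so the fuel left at [s] still suffices. *)
Lemma locate_shift fuel s j : tile_start s -> s <= j -> j < L + fuel ->
  exists2 f, j < s + f & locate fuel L j = locate f s j.
Proof.
move=> rs; elim: rs j => [|t rt IH] j sj jf; first by exists fuel.
have [ | | [|f] jtf ->] := IH j => //; [lia|lia|].
exists f => /=; first by have := tile_gt0 t; lia.
by rewrite ifF //; lia.
Qed.

Lemma weight_tile s o : tile_start s -> o < size (tile s) ->
  weight (s + o) = nth 0 (tile s) o.
Proof.
move=> rs os; have := tile_start_ge rs => Ls.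
rewrite /weight ifF; last lia.
have [ | | [|f] jtf ->] := @locate_shift (s + o).+1 s (s + o) rs; [lia|lia|lia|].
by rewrite /= ifT ?ltn_add2l //; congr nth; lia.
Qed.

Lemma weight_head s : tile_start s -> weight s = head 0 (tile s).
Proof.
by move=> rs; rewrite -[s in LHS]addn0 weight_tile // nth0.
Qed.

Lemma weight_tile_prefix s m : tile_start s -> m <= size (tile s) ->
  \sum_(s <= i < s + m) weight i = sumn (take m (tile s)).
Proof.
move=> rs; elim: m => [|m IH] ms; first by rewrite addn0 big_geq // take0.
rewrite addnS big_nat_recr /=; last lia.
rewrite IH; last lia.
by rewrite weight_tile // (take_nth 0) // -cats1 sumn_cat /= addn0.
Qed.

Lemma sumn_take_le (s : seq nat) m : sumn (take m s) <= sumn s.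
Proof. by rewrite -[s in leqRHS](cat_take_drop m) sumn_cat leq_addr. Qed.

Lemma weight_sum_start s : tile_start s -> \sum_(L <= i < s) weight i = s - L.
Proof.
elim=> [|t rt IH]; first by rewrite big_geq // subnn.
have := tile_start_ge rt => Lt.
rewrite (@big_cat_nat _ _ _ t) //=; [|lia].
by rewrite IH weight_tile_prefix // take_size tile_sum; lia.
Qed.

(** Complete tiles contribute exactly their length; only the tile that [m] cuts can exceed the mean,
    by at most its size. *)
Lemma weight_sum_le m : L <= m -> \sum_(L <= i < m) weight i <= m - L + D.
Proof.
move=> Lm; have [s [ o [rs jo os]]] := tile_cover Lm; rewrite jo.
have := tile_start_ge rs => Ls.
rewrite (@big_cat_nat _ _ _ s) //=; [|lia].
rewrite weight_sum_start // weight_tile_prefix //; [|lia].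
have := sumn_take_le (tile s) o; rewrite tile_sum.
by have := tile_le s; lia.
Qed.

Lemma tile_prev s : tile_start s -> L < s ->
  exists t, [/\ tile_start t, s = t + size (tile t), 0 < size (tile t) &
    weight s.-1 = last 0 (tile t)].
Proof.
case=> [|t rt] Ls; first lia.
exists t; split=> //.
have tp := tile_gt0 t.
have -> : (t + size (tile t)).-1 = t + (size (tile t)).-1 by lia.
by rewrite weight_tile ?nth_last //; lia.
Qed.

End Tiling.

Lemma leq_sum_sub (f : nat -> nat) (s : seq nat) a b : uniq s ->
  all (fun i => a <= i < b) s -> \sum_(i <- s) f i <= \sum_(a <= i < b) f i.
Proof.
move=> us /allP h; rewrite /index_iota.
apply: (@uniq_sub_le_big nat addn leq) => //.
- by move=> x y; exact: leq_addr.
- exact: iota_uniq.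
- by move=> i /h; rewrite mem_iota; lia.
Qed.

(** * Cut profiles and the dual constraints *)

Section Profile.
Variables (n L d : nat) (X : nat -> nat -> nat).

(* X i j stands for the number of edges joining a position below i to a position at or
   above j, in a graph on 0, ..., n.-1 whose vertices at L, ..., n.-1 have degree d.
   For prof_right and prof_left, count the neighbours outside [I, m) (resp. [m, I)) of the
   positions between S and k: each has at least d + 1 - (m - I) of them. *)
Record profile := Profile {
  prof_homol : forall i i' j, i <= i' -> X i j <= X i' j;
  prof_homor : forall i j j', j <= j' -> X i j' <= X i j;
  prof_right : forall I S k m, L <= S -> I <= S <= k -> k <= m -> k <= n ->
    (k - S) * (d + 1 - (m - I)) + X I k + X I m <= X k m + X I S;
  prof_left : forall I S k m, L <= k -> m <= k <= S -> S <= I -> I <= n ->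
    (S - k) * (d + 1 - (I - m)) + X k I + X m I <= X m k + X S I;
  prof_rect : forall S k m, S <= k <= m ->
    X k k + X S m <= X S k + X k m + (k - S) * (m - k);
  prof_step : forall i, L <= i < n ->
    X i i + X i.+1 i.+1 = d + 2 * X i i.+1;
  prof_top : forall i j, n <= j -> X i j = 0;
  prof_cut : forall i, 0 < i < n -> 0 < X i i;
  prof_even : forall i, ~~ odd d -> L <= i -> ~~ odd (X i i) }.

(** The sum stops at [j + D], so that a decreasing factor on the gaps is at least its value at
    [j + D] on all terms that are kept. *)
Definition coverage (W : nat -> nat) D j :=
  \sum_(L <= i < j + D) W i * X (minn i j) (maxn i j).

Lemma coverage_ge W D j (s t : seq nat) : uniq s -> uniq t ->
  all (fun i => L <= i <= j) s -> all (fun i => j < i < j + D) t ->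
  L <= j -> 0 < D ->
  \sum_(i <- s) W i * X i j + \sum_(i <- t) W i * X j i <= coverage W D j.
Proof.
move=> us ut /allP hs /allP ht Lj D0.
rewrite /coverage (@big_cat_nat _ _ _ j.+1) //=; try lia.
have eqs i : i \in s -> W i * X i j = W i * X (minn i j) (maxn i j).
  by move/hs => ij; rewrite (minn_idPl _) ?(maxn_idPr _) //; lia.
have eqt i : i \in t -> W i * X j i = W i * X (minn i j) (maxn i j).
  by move/ht => ij; rewrite (minn_idPr _) ?(maxn_idPl _) //; lia.
apply: leq_add.
- rewrite (eq_big_seq _ eqs); apply: leq_sum_sub => //.
  by apply/allP => i /hs; lia.
- rewrite (eq_big_seq _ eqt); apply: leq_sum_sub => //.
  by apply/allP => i /ht; lia.
Qed.

(** A pair [(w, i)] claims weight [w] at gap [i]. Every coverage bound below comes from a few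
    claimed gaps, those of [s] up to [j] and those of [t] beyond it. *)
Lemma coverage_ge_pairs W D j (s t : seq (nat * nat)) :
  uniq (map snd s) -> uniq (map snd t) ->
  all (fun p => (L <= p.2 <= j) && (p.1 <= W p.2)) s ->
  all (fun p => (j < p.2 < j + D) && (p.1 <= W p.2)) t ->
  L <= j -> 0 < D ->
  \sum_(p <- s) p.1 * X p.2 j + \sum_(p <- t) p.1 * X j p.2 <= coverage W D j.
Proof.
move=> us ut /allP hs /allP ht Lj D0.
apply: leq_trans (coverage_ge W us ut _ _ Lj D0).
- rewrite !big_map leq_add //; rewrite !big_seq; apply: leq_sum => p.
    by move/hs/andP=> [_ ?]; rewrite leq_mul.
  by move/ht/andP=> [_ ?]; rewrite leq_mul.
- by apply/allP => _ /mapP[p /hs /andP[? _] ->].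
- by apply/allP => _ /mapP[p /ht /andP[? _] ->].
Qed.

End Profile.

Arguments prof_homol {n L d X} p i i' j _.
Arguments prof_homor {n L d X} p i j j' _.
Arguments prof_right {n L d X} p I S k m _ _ _ _.
Arguments prof_left {n L d X} p I S k m _ _ _ _.
Arguments prof_rect {n L d X} p S k m _.
Arguments prof_step {n L d X} p i _.
Arguments prof_top {n L d X} p i j _.
Arguments prof_cut {n L d X} p i _.
Arguments prof_even {n L d X} p i _ _.

(* Dual feasibility in the linear program that minimizes the conductance of a profile. *)
Definition dual_weights n L X c D (W : nat -> nat) :=
  (forall m, L <= m -> \sum_(L <= i < m) W i <= m - L + D) /\
  (forall j, L + D <= j < n -> c <= coverage L X W D j).

(** * Weights for odd degree *)

Section Odd.
Variables (n L d : nat) (X : nat -> nat -> nat).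
Hypotheses (d3 : 3 <= d) (oddd : odd d) (L0 : 0 < L) (prof : profile n L d X).

(* Small cuts take the weight of gaps that follow them, which many edges cross. *)
Definition odd_tile s :=
  if X s s == 1 then [:: d.-1, 1 & nseq d.-2 0]
  else if 2 * X s s < d then [:: d./2, 1, 1 & nseq d./2.-1 0]
  else [:: 1].

Let W := weight odd_tile L.
Let tstart := tile_start odd_tile L.

Lemma odd_tile_gt0 s : 0 < size (odd_tile s).
Proof. by rewrite /odd_tile; case: ifP => // _; case: ifP. Qed.

Lemma odd_tile_le s : size (odd_tile s) <= 2 * d.
Proof.
rewrite /odd_tile; case: ifP => [_|_]; rewrite /= ?size_nseq; first lia.
case: ifP => _; rewrite /= ?size_nseq; lia.
Qed.

Lemma odd_tile_sum s : sumn (odd_tile s) = size (odd_tile s).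
Proof.
rewrite /odd_tile; case: ifP => [_|_].
  rewrite /= sumn_nseq size_nseq; lia.
case: ifP => _ //; rewrite /= sumn_nseq size_nseq; lia.
Qed.

Lemma odd_tile_head s : 0 < head 0 (odd_tile s).
Proof. rewrite /odd_tile; case: ifP => [_|_] /=; [lia|]; case: ifP => _ /=; lia. Qed.

Lemma odd_weight_start s : tstart s -> 0 < W s.
Proof. by move=> rs; rewrite /W (weight_head odd_tile_gt0 rs) odd_tile_head. Qed.

(** After a small cut at [s], the vertices from [s] on have few edges backwards, so [prof_right]
    finds many edges across the later gaps of the tile. A tile [[:: 1]] has a cut above [d / 2],
    which needs only positive weights on both neighbouring gaps. *)
Lemma odd_coverage j : L + 2 * d <= j < n -> d - 1 <= coverage L X W (2 * d) j.
Proof.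
move=> jn; have Lj : L <= j by lia.
have [s [ o [rs js os]]] := tile_cover odd_tile_gt0 Lj.
have Ls := tile_start_ge rs.
have nxt := tile_startS rs; have Wn := odd_weight_start nxt.
have Wo o' : o' < size (odd_tile s) -> W (s + o') = nth 0 (odd_tile s) o'.
  by move=> ho; rewrite /W (weight_tile odd_tile_gt0 rs ho).
have e0 : 0 < X s s by apply: (prof_cut prof); lia.
have hR := prof_right prof; have hRect := prof_rect prof.
have D0 : 0 < 2 * d by lia.
have cov := @coverage_ge_pairs L X W (2 * d) j _ _ _ _ _ _ Lj D0.
clear nxt; move: os Wo Wn; rewrite /odd_tile.
case: eqP => [e1|ne1].
  rewrite /= size_nseq => os Wo Wn.
  have {}Wn : 0 < W (s + d) by move: Wn; have -> : d.-2.+2 = d by lia.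
  have W0 : W s = d.-1 by rewrite -[s]addn0 Wo.
  have W1 : W (s + 1) = 1 by rewrite Wo //; lia.
  have [ o0|[ o1|o2]] : o = 0 \/ o = 1 \/ 2 <= o by lia.
  - apply: leq_trans (cov [:: (d.-1, s)] [::] _ _ _ _); try by rewrite /= ?inE; lia.
    by rewrite !big_cons !big_nil js o0 /= !addn0 e1; lia.
  - apply: leq_trans (cov [:: (1, s + 1)] [::] _ _ _ _); try by rewrite /= ?inE; lia.
    rewrite !big_cons !big_nil js o1 /=.
    have := hR s s (s + 1) (s + 1); lia.
  (* [X (s + 1) j] is at least [d - o] and [X j (s + d)] at least [o - 1]; the sum is [d - 1] for
     every [o]. *)
  - apply: leq_trans (cov [:: (1, s + 1)] [:: (1, s + d)] _ _ _ _); try by rewrite /= ?inE; lia.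
      rewrite !big_cons !big_nil /=.
      have := hR s s (s + 1) j; have := hR s s j (s + d).
      have -> : s + d - s = d by lia.
      have -> : d + 1 - d = 1 by lia.
      have -> : j - s = o by lia.
      have -> : s + 1 - s = 1 by lia.
      rewrite muln1 mul1n; lia.
case: ifP => [e2|ne2].
  rewrite /= size_nseq => os Wo Wn.
  have {}Wn : 0 < W (s + (d./2 + 2)).
    by move: Wn; have -> : d./2.-1.+3 = d./2 + 2 by lia.
  have W0 : W s = d./2 by rewrite -[s]addn0 Wo.
  have W1 : W (s + 1) = 1 by rewrite Wo //; lia.
  have W2 : W (s + 2) = 1 by rewrite Wo //; lia.
  have [ o0|[ o1|[ o2|o3]]] : o = 0 \/ o = 1 \/ o = 2 \/ 3 <= o by lia.
  - apply: leq_trans (cov [:: (d./2, s)] [::] _ _ _ _); try by rewrite /= ?inE; lia.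
    by rewrite !big_cons !big_nil js o0 /= !addn0; nia.
  - apply: leq_trans (cov [:: (1, s); (1, s + 1)] [:: (1, s + 2)] _ _ _ _); try by rewrite /= ?inE; lia.
    rewrite !big_cons !big_nil js o1 /=.
    have := hR s s (s + 1) (s + 1); have := hRect s (s + 1) (s + 2).
    lia.
  - apply: leq_trans (cov [:: (1, s + 2)] [::] _ _ _ _); try by rewrite /= ?inE; lia.
    rewrite !big_cons !big_nil js o2 /=.
    have := hR s s (s + 2) (s + 2); lia.
  - apply: leq_trans (cov [:: (1, s + 2)] [:: (1, s + (d./2 + 2))] _ _ _ _); try by rewrite /= ?inE; lia.
      rewrite !big_cons !big_nil /=.
      have := hR s s j j; have := hRect (s + 2) j (s + (d./2 + 2)).
      have -> : j - s = o by lia.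
      have -> : j - (s + 2) = o - 2 by lia.
      have -> : s + (d./2 + 2) - j = d./2 + 2 - o by lia.
      nia.
rewrite /= => os Wo Wn.
have o0 : o = 0 by lia.
have W0 : W s = 1 by rewrite -[s]addn0 Wo.
rewrite o0 addn0 in js; subst j.
have [big|small] := leqP (d - 1) (X s s).
  apply: leq_trans (cov [:: (1, s)] [::] _ _ _ _); try by rewrite /= ?inE; lia.
  by rewrite !big_cons !big_nil /=; lia.
have [|t [rt st tp Wt]] := tile_prev odd_tile_gt0 rs; first by lia.
have Lt := tile_start_ge rt.
have et0 : 0 < X t t by apply: (prof_cut prof); lia.
(* If the previous tile ended in zeros, its length would force [X s s] to be at least [d - 1],
   against [small]. *)
have Wp : 0 < W s.-1.
  rewrite /W Wt /odd_tile; case: eqP => [e1|ne1'].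
    have := hR t t s s.
    have -> : s - t = d by rewrite st /odd_tile e1 /= size_nseq; lia.
    lia.
  case: ifP => [e2|//].
  have d5 : 5 <= d by lia.
  have ds : s - t = d./2 + 2 by rewrite st /odd_tile ifF ?e2 /= ?size_nseq; lia.
  have := hR t t s s; rewrite ds; nia.
apply: leq_trans (cov [:: (1, s.-1); (1, s)] [:: (1, s + 1)] _ _ _ _); try by rewrite /= ?inE; lia.
rewrite !big_cons !big_nil /=.
have := hRect s.-1 s (s + 1); lia.
Qed.

Lemma odd_dual_weights : exists W, dual_weights n L X (d - 1) (2 * d) W.
Proof.
exists W; split; last exact: odd_coverage.
by move=> m Lm; apply: (weight_sum_le odd_tile_gt0 odd_tile_le odd_tile_sum).
Qed.

End Odd.

(** * Weights for degree four *)

Section Four.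
Variables (n L : nat) (X : nat -> nat -> nat).
Hypotheses (L0 : 0 < L) (prof : profile n L 4 X).

(** Adjacent cuts sum to at least [d], so among the even degrees only [d = 4] allows two consecutive
    cuts of size 2; this case needs its own tiles. The test at [s + 5] makes the next tile start
    there if that cut is 2, so that it receives weight 2. *)
Definition four_tile s :=
  if X s s == 2 then
    if X (s + 1) (s + 1) == 2 then
      if X (s + 5) (s + 5) == 2 then [:: 2; 2; 0; 1; 0] else [:: 2; 2; 0; 1; 1; 0]
    else [:: 2; 1; 0]
  else [:: 1].

Let W := weight four_tile L.

Lemma four_tile_gt0 s : 0 < size (four_tile s).
Proof. by rewrite /four_tile; do !case: ifP. Qed.

Lemma four_tile_le s : size (four_tile s) <= 8.
Proof. by rewrite /four_tile; do !case: ifP. Qed.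

Lemma four_tile_sum s : sumn (four_tile s) = size (four_tile s).
Proof. by rewrite /four_tile; do !case: ifP. Qed.

Lemma four_weight_start s : tile_start four_tile L s ->
  if X s s == 2 then 2 <= W s else 1 <= W s.
Proof.
move=> rs; rewrite /W (weight_head four_tile_gt0 rs) /four_tile.
by do !case: ifP.
Qed.

Lemma four_coverage j : L + 8 <= j < n -> 4 <= coverage L X W 8 j.
Proof.
move=> jn; have Lj : L <= j by lia.
have [s [ o [rs js os]]] := tile_cover four_tile_gt0 Lj.
have Ls := tile_start_ge rs.
have := four_weight_start (tile_startS rs).
have Wo o' : o' < size (four_tile s) -> W (s + o') = nth 0 (four_tile s) o'.
  by move=> ho; rewrite /W (weight_tile four_tile_gt0 rs ho).
have hR := prof_right prof; have hRect := prof_rect prof.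
have hstep := prof_step prof.
have heven i : L <= i < n -> X i i = 2 \/ 4 <= X i i.
  move=> ?; have := prof_cut prof i; have := prof_even prof i isT.
  by lia.
have D0 : 0 < 8 by [].
have cov := @coverage_ge_pairs L X W 8 j _ _ _ _ _ _ Lj D0.
have es := heven s; have ej := heven j.
move: os Wo; rewrite /four_tile.
case: eqP => [e0|ne0]; last first.
  move=> /= os Wo _; have o0 : o = 0 by lia.
  have W0 : W s = 1 by rewrite -[s]addn0 Wo.
  rewrite o0 addn0 in js; subst j.
  apply: leq_trans (cov [:: (1, s)] [::] _ _ _ _); try by rewrite /= ?inE; lia.
  by rewrite !big_cons !big_nil /=; lia.
case: eqP => [e1|ne1]; last first.
  move=> /= os Wo Wn.
  have {}Wn : 0 < W (s + 3) by move: Wn; case: ifP; lia.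
  have W0 : W s = 2 by rewrite -[s]addn0 Wo.
  have W1 : W (s + 1) = 1 by rewrite Wo.
  have [ o0|[ o1|o2]] : o = 0 \/ o = 1 \/ o = 2 by lia.
  - rewrite o0 addn0 in js; subst j.
    apply: leq_trans (cov [:: (2, s)] [::] _ _ _ _); try by rewrite /= ?inE; lia.
    by rewrite !big_cons !big_nil /= e0.
  - rewrite o1 in js; subst j.
    apply: leq_trans (cov [:: (1, s + 1)] [::] _ _ _ _); try by rewrite /= ?inE; lia.
    by rewrite !big_cons !big_nil /=; lia.
  - rewrite o2 in js; subst j.
    apply: leq_trans (cov [:: (1, s + 1)] [:: (1, s + 3)] _ _ _ _); try by rewrite /= ?inE; lia.
    rewrite !big_cons !big_nil /=.
    have := hR s s (s + 3) (s + 3); have := hR s s (s + 2) (s + 2).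
    have := heven (s + 1).
    have := hstep (s + 1); have := hstep (s + 2); rewrite -!addnS.
    lia.
have X01 : X s (s + 1) = 0 by have := hR s s (s + 1) (s + 1); lia.
have [e5|ne5] := eqVneq (X (s + 5) (s + 5)) 2.
  move=> /= os Wo Wn; rewrite e5 eqxx in Wn.
  have W0 : W s = 2 by rewrite -[s]addn0 Wo.
  have W1 : W (s + 1) = 2 by rewrite Wo.
  have W3 : W (s + 3) = 1 by rewrite Wo.
  have [ o0|[ o1|[ o2|[ o3|o4]]]] : o = 0 \/ o = 1 \/ o = 2 \/ o = 3 \/ o = 4 by lia.
  - rewrite o0 addn0 in js; subst j.
    apply: leq_trans (cov [:: (2, s)] [::] _ _ _ _); try by rewrite /= ?inE; lia.
    by rewrite !big_cons !big_nil /= e0.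
  - rewrite o1 in js; subst j.
    apply: leq_trans (cov [:: (2, s + 1)] [::] _ _ _ _); try by rewrite /= ?inE; lia.
    by rewrite !big_cons !big_nil /= e1.
  - rewrite o2 in js; subst j.
    apply: leq_trans (cov [:: (2, s + 1)] [:: (1, s + 3)] _ _ _ _); try by rewrite /= ?inE; lia.
    rewrite !big_cons !big_nil /=.
    have := hRect s (s + 1) (s + 2); have := hR (s + 1) (s + 1) (s + 2) (s + 3).
    lia.
  - rewrite o3 in js; subst j.
    apply: leq_trans (cov [:: (1, s + 3)] [::] _ _ _ _); try by rewrite /= ?inE; lia.
    rewrite !big_cons !big_nil /=.
    have := hR (s + 1) (s + 1) (s + 3) (s + 3); lia.
  - rewrite o4 in js; subst j.
    apply: leq_trans (cov [:: (1, s + 3)] [:: (2, s + 5)] _ _ _ _); try by rewrite /= ?inE; lia.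
    rewrite !big_cons !big_nil /=.
    have := hR (s + 1) (s + 1) (s + 3) (s + 4).
    have := hR (s + 1) (s + 1) (s + 4) (s + 5); lia.
move=> /= os Wo Wn.
have W0 : W s = 2 by rewrite -[s]addn0 Wo.
have W1 : W (s + 1) = 2 by rewrite Wo.
have W3 : W (s + 3) = 1 by rewrite Wo.
have W4 : W (s + 4) = 1 by rewrite Wo.
have [ o0|[ o1|[ o2|[ o3|[ o4|o5]]]]] :
  o = 0 \/ o = 1 \/ o = 2 \/ o = 3 \/ o = 4 \/ o = 5 by lia.
- rewrite o0 addn0 in js; subst j.
  apply: leq_trans (cov [:: (2, s)] [::] _ _ _ _); try by rewrite /= ?inE; lia.
  by rewrite !big_cons !big_nil /= e0.
- rewrite o1 in js; subst j.
  apply: leq_trans (cov [:: (2, s + 1)] [::] _ _ _ _); try by rewrite /= ?inE; lia.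
  by rewrite !big_cons !big_nil /= e1.
- rewrite o2 in js; subst j.
  apply: leq_trans (cov [:: (2, s + 1)] [:: (1, s + 3)] _ _ _ _); try by rewrite /= ?inE; lia.
  rewrite !big_cons !big_nil /=.
  have := hRect s (s + 1) (s + 2); have := hR (s + 1) (s + 1) (s + 2) (s + 3).
  lia.
- rewrite o3 in js; subst j.
  apply: leq_trans (cov [:: (1, s + 3)] [::] _ _ _ _); try by rewrite /= ?inE; lia.
  rewrite !big_cons !big_nil /=.
  have := hR (s + 1) (s + 1) (s + 3) (s + 3); lia.
- rewrite o4 in js; subst j.
  apply: leq_trans (cov [:: (1, s + 4)] [::] _ _ _ _); try by rewrite /= ?inE; lia.
  rewrite !big_cons !big_nil /=.
  have := hR (s + 1) (s + 1) (s + 4) (s + 4); lia.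
- rewrite o5 in js; subst j.
  have h4 := hR (s + 1) (s + 1) (s + 4) (s + 4).
  have st4 := hstep (s + 4); have st5 := hstep (s + 5); rewrite -!addnS in st4 st5.
  have [n6|n6] := eqVneq n (s + 6).
    (* The gap is the last one, and no tile follows. All edges of the last vertex go down, and
       [prof_left] at [n] finds 2 of them from below [s + 3] and 3 from below [s + 4]. *)
    have hL := prof_left prof; have h6 := prof_top prof.
    apply: leq_trans (cov [:: (1, s + 3); (1, s + 4)] [::] _ _ _ _); try by rewrite /= ?inE; lia.
    rewrite !big_cons !big_nil /=.
    have := hL n n (s + 5) (s + 3); have := hL n n (s + 5) (s + 4).
    rewrite !(h6 _ n) //; lia.
  have e6 := heven (s + 6).
  move: Wn; case: eqP => [e6'|ne6] Wn.
    apply: leq_trans (cov [:: (1, s + 4)] [:: (2, s + 6)] _ _ _ _); try by rewrite /= ?inE; lia.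
    by rewrite !big_cons !big_nil /=; lia.
  apply: leq_trans (cov [:: (1, s + 4)] [:: (1, s + 6)] _ _ _ _); try by rewrite /= ?inE; lia.
  by rewrite !big_cons !big_nil /=; lia.
Qed.

Lemma four_dual_weights : exists W, dual_weights n L X 4 8 W.
Proof.
exists W; split; last exact: four_coverage.
by move=> m Lm; apply: (weight_sum_le four_tile_gt0 four_tile_le four_tile_sum).
Qed.

End Four.

(** * Weights for even degree at least six *)

Section Even.
Variables (n L d : nat) (X : nat -> nat -> nat).
Hypotheses (d6 : 6 <= d) (evend : ~~ odd d) (L0 : 0 < L) (prof : profile n L d X).

Definition two k := X k k == 2.
(** From [2 d / 3] on, weight 1 at the cut and two units on either side give [3 X - 4 >= 2 d - 4],
    see [coverage_five]. Cuts below this bound need more weight. *)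
Definition mid k := (4 <= X k k) && (3 * X k k < 2 * d).
(** Weight beyond 1 for a [mid] cut: below [d / 2], the total [d / 2 - 1] times a cut of at least 4
    is [2 d - 4]; from [d / 2] on, the total 2 gives [4 X - 4] by [coverage_five]. *)
Definition extra k := if 2 * X k k < d then d./2 - 2 else 1.
Definition zone k := extra k + (if mid (k + 1) then extra (k + 1) else 0).

(** A 2-cut with weight [d - 3] yields [2 d - 6], and weight 2 on the gaps just before and after it
    yields the missing 2. So 2-cuts must fall on tile starts and be preceded by weight 2. After a
    tile of length [d + 1], a 2-cut at [s + d + 2] would be one place past a start; the first form
    is therefore shorter and is followed by [[:: 0; 2]]. In the tile of a [mid] cut, the zeros pay
    for the extra weights. *)
Definition even_tile s :=
  if two s then
    if two (s + d + 2) then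
      [:: d - 3, 2 & nseq (d./2 - 1) 0 ++ 1 :: nseq (d./2 - 2) 0]
    else [:: d - 3, 2 & rcons (nseq (d - 2) 0) 2]
  else if two (s + 2) then [:: 0; 2]
  else if mid s then
    [:: 1 + extra s, 1 + (if mid (s + 1) then extra (s + 1) else 0), 1, 1 &
        nseq (zone s) 0]
  else [:: 1].

Let W := weight even_tile L.
Let tstart := tile_start even_tile L.

Local Notation hR := (prof_right prof).
Local Notation hL := (prof_left prof).
Local Notation hRect := (prof_rect prof).

Lemma even_tile_gt0 s : 0 < size (even_tile s).
Proof. by rewrite /even_tile; do !case: ifP. Qed.

Lemma mid_lt k : mid k -> k < n.
Proof.
rewrite /mid; case: (ltnP k n) => // nk; rewrite (prof_top prof) //; lia.
Qed.

Lemma two_lt k : two k -> k < n.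
Proof.
rewrite /two; case: (ltnP k n) => // nk; rewrite (prof_top prof) //.
Qed.

Lemma block_cut i k : L <= i -> i <= k <= n ->
  (k - i) * (d + 1 - (k - i)) <= X k k + X i i.
Proof. by move=> Li ik; have := hR i i k k; lia. Qed.

(** For [l] between 1 and [d], the product [l (d + 1 - l)] of [block_cut] is at least [d]. *)
Lemma far_cut i k : L <= i -> i < k <= n -> X k k + X i i < d -> d < k - i.
Proof.
move=> Li ik e; have := block_cut Li (k := k); rewrite leqNgt => h.
by apply/negP => ?; nia.
Qed.

Lemma two_two i k : L <= i -> two i -> two k -> i < k -> d < k - i.
Proof.
move=> Li ti tk ik; have := two_lt tk => ?; apply: far_cut => //; [lia|].
by move: ti tk; rewrite /two => /eqP-> /eqP->; lia.
Qed.

Lemma mid_two i k : L <= i -> mid i -> two k -> i < k -> d < k - i.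
Proof.
move=> Li ti tk ik; have := two_lt tk => ?; apply: far_cut => //; [lia|].
by move: ti tk; rewrite /two /mid => ? /eqP->; lia.
Qed.

Lemma mid_mid i k : L <= i -> mid i -> mid k -> i + 1 < k -> d <= k - i.
Proof.
move=> Li mi mk ik; have := mid_lt mk => ?; rewrite leqNgt; apply/negP => ?.
have := @block_cut i k Li; move: mi mk; rewrite /mid => ? ? h.
have {}h := h _; nia.
Qed.

(** Since adjacent cuts sum to at least [d], the cuts at [s] and [s + 1] are not both below [d / 2],
    and at most one of the two extra weights is the large one. *)
Lemma zone_bounds s : L <= s -> mid s ->
  [/\ 0 < extra s, zone s <= d - 6, 8 <= d & mid (s + 1) || (zone s <= d - 7)].
Proof.
move=> Ls ms; rewrite /zone /extra.
case: (boolP (mid (s + 1))) => m1; last first.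
  by move: ms; rewrite /mid addn0 => ms; split; do ?case: ifP; lia.
have := mid_lt m1 => s1.
have := hR s s (s + 1) (s + 1); move: ms m1; rewrite /mid => ms m1 h.
by split=> //; do ?case: ifP; lia.
Qed.

Lemma even_tile_le s : size (even_tile s) <= 2 * d.
Proof.
rewrite /even_tile; do ?case: ifP => _;
  rewrite /= ?size_rcons ?size_cat /= ?size_nseq /zone /extra;
  do ?case: ifP => _; lia.
Qed.

Lemma even_tile_sum s : sumn (even_tile s) = size (even_tile s).
Proof.
rewrite /even_tile /zone; case: (mid (s + 1)); do ?case: ifP => // _;
  rewrite /= -?cats1 ?sumn_cat ?size_cat /= ?sumn_nseq ?size_nseq; lia.
Qed.

Lemma tile_chain s : two s -> two (s + d + 2) ->
  even_tile s = [:: d - 3, 2 & nseq (d./2 - 1) 0 ++ 1 :: nseq (d./2 - 2) 0].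
Proof. by rewrite /even_tile => -> ->. Qed.

Lemma tile_two s : two s -> ~~ two (s + d + 2) ->
  even_tile s = [:: d - 3, 2 & rcons (nseq (d - 2) 0) 2].
Proof. by rewrite /even_tile => -> /negPf->. Qed.

Lemma tile_before s : ~~ two s -> two (s + 2) -> even_tile s = [:: 0; 2].
Proof. by rewrite /even_tile => /negPf-> ->. Qed.

Lemma tile_mid s : ~~ two s -> ~~ two (s + 2) -> mid s -> even_tile s =
    [:: 1 + extra s, 1 + (if mid (s + 1) then extra (s + 1) else 0), 1, 1 &
        nseq (zone s) 0].
Proof. by rewrite /even_tile => /negPf-> /negPf-> ->. Qed.

Lemma tile_single s : ~~ two s -> ~~ two (s + 2) -> ~~ mid s -> even_tile s = [:: 1].
Proof. by rewrite /even_tile => /negPf-> /negPf-> /negPf->. Qed.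

Lemma size_tile_chain s : two s -> two (s + d + 2) -> size (even_tile s) = d.
Proof. by move=> *; rewrite tile_chain //= size_cat /= !size_nseq; lia. Qed.

Lemma size_tile_two s : two s -> ~~ two (s + d + 2) -> size (even_tile s) = d + 1.
Proof. by move=> *; rewrite tile_two //= size_rcons !size_nseq; lia. Qed.

Lemma size_tile_mid s : ~~ two s -> ~~ two (s + 2) -> mid s ->
  size (even_tile s) = 4 + zone s.
Proof. by move=> *; rewrite tile_mid //= !size_nseq; lia. Qed.

Variant tile_spec s : Prop :=
| TileChain of two s & two (s + d + 2)
| TileTwo of two s & ~~ two (s + d + 2)
| TileBefore of ~~ two s & two (s + 2)
| TileMid of ~~ two s & ~~ two (s + 2) & mid s
| TileSingle of ~~ two s & ~~ two (s + 2) & ~~ mid s.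

Lemma tileP s : tile_spec s.
Proof.
case: (boolP (two s)) => [t|nt].
  by case: (boolP (two (s + d + 2))); [apply: TileChain|apply: TileTwo].
case: (boolP (two (s + 2))) => [t|nt2]; first exact: TileBefore.
by case: (boolP (mid s)); [apply: TileMid|apply: TileSingle].
Qed.

Hypothesis two_L : ~~ two (L + 1).

(** This invariant keeps 2-cuts on tile starts. Small cuts are more than [d] apart, so only a 2-cut
    right behind the current tile could break it, and the choice of tile looks ahead for that. *)
Lemma no_two_next s : tstart s -> ~~ two (s + 1).
Proof.
case=> [//|t rt]; apply/negP => tw; have Lt := tile_start_ge rt.
case: (tileP t) tw => [t1 t2|t1 t2|t1 t2|t1 t2 t3|t1 t2 t3].
- rewrite size_tile_chain // => tw.
  by have := two_two _ tw t2; lia.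
- rewrite size_tile_two //.
  have -> : t + (d + 1) + 1 = t + d + 2 by lia.
  by rewrite (negPf t2).
- rewrite tile_before // => tw; have := two_two _ t2 tw; rewrite /=; lia.
- rewrite size_tile_mid // => tw; have := mid_two _ t3 tw.
  have [] := zone_bounds Lt t3; lia.
- by rewrite tile_single //= -addnA (negPf t2).
Qed.

Lemma W_tile s o : tstart s -> o < size (even_tile s) ->
  W (s + o) = nth 0 (even_tile s) o.
Proof. by move=> rs ho; rewrite /W (weight_tile even_tile_gt0 rs ho). Qed.

Lemma W_head s : tstart s -> W s = head 0 (even_tile s).
Proof. by move=> rs; rewrite /W (weight_head even_tile_gt0 rs). Qed.

Lemma W_pos s : tstart s -> ~~ two s -> ~~ two (s + 2) -> 0 < W s.
Proof.
move=> rs n1 n2; rewrite W_head //; case: (boolP (mid s)) => m.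
  by rewrite tile_mid.
by rewrite tile_single.
Qed.

(** Two units of weight on one side of a gap, [a] being its nearest neighbour on that side and [b]
    the next one. *)
Definition good_pair a b := (1 < W a) || ((0 < W a) && (0 < W b)).

Lemma right_good s : tstart s -> ~~ two s -> ~~ two (s + 2) -> ~~ two (s + 3) ->
  good_pair s (s + 1).
Proof.
move=> rs n1 n2 n3; have := W_pos rs n1 n2; rewrite /good_pair => Wp.
case: (boolP (mid s)) => m.
  have [? _ _ _] := zone_bounds (tile_start_ge rs) m.
  by rewrite W_head // tile_mid //=; lia.
have rs1 := tile_startS rs; rewrite tile_single //= in rs1.
have := W_pos rs1 (no_two_next rs); rewrite -addnA => /(_ n3); lia.
Qed.

(** The left side lacks weight only when the zeros of a [mid] tile end at [s] or one place before.
    Then the distance to that [mid] cut makes the cut at [s] large. *)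
Variant left_spec s : Prop :=
| LeftGood of good_pair s.-1 s.-2
| LeftMid t of L <= t & mid t & s = t + 4 + zone t
| LeftMid1 t of L <= t & mid t & s = t + 5 + zone t & 0 < W s.-1.

Lemma left_cases s : tstart s -> L < s -> ~~ two s -> ~~ two (s + 2) ->
  0 < W s.-1 /\ (1 < W s.-1 \/ tstart s.-1 /\ even_tile s.-1 = [:: 1]) \/
  exists t, [/\ L <= t, mid t & s = t + 4 + zone t].
Proof.
move=> rs Ls n1 n2; have [t [rt st tp Wt]] := tile_prev even_tile_gt0 rs Ls.
have Lt := tile_start_ge rt; rewrite -/W in Wt.
case: (tileP t) => [t1 t2|t1 t2|t1 t2|t1 t2 t3|t1 t2 t3].
- by move: n2; rewrite st size_tile_chain // t2.
- left; rewrite Wt tile_two //= last_rcons; split=> //; by left.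
- by move: n1; rewrite st tile_before //= t2.
- right; exists t; split=> //; rewrite st size_tile_mid //; lia.
- left; rewrite Wt tile_single //=; split=> //; right.
  have -> : s.-1 = t by rewrite st tile_single //=; lia.
  by rewrite tile_single.
Qed.

Lemma leftP s : tstart s -> L + 1 < s -> ~~ two s -> ~~ two (s + 2) -> left_spec s.
Proof.
move=> rs Ls n1 n2.
case: (left_cases rs _ n1 n2); first lia; last first.
  by case=> t [? ? ?]; apply: (LeftMid (t := t)).
case=> Wp [W2|[rs1 ts1]]; first by apply: LeftGood; rewrite /good_pair W2.
have n3 : ~~ two s.-1.
  by apply/negP => t; move: ts1; rewrite /even_tile t; case: ifP.
have n4 : ~~ two (s.-1 + 2).
  by apply/negP => t; move: ts1; rewrite /even_tile (negPf n3) t.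
case: (left_cases rs1 _ n3 n4); first lia.
  by case=> W2 _; apply: LeftGood; rewrite /good_pair Wp W2 orbT.
by case=> t [? ? ?]; apply: (LeftMid1 (t := t)) => //; lia.
Qed.

Section Gap.
Variable j : nat.
Hypothesis jn : L + 2 * d <= j < n.

Lemma Lj : L <= j. Proof. lia. Qed.
Lemma D0 : 0 < 2 * d. Proof. lia. Qed.

Let cov := fun s t a b c e =>
  @coverage_ge_pairs L X W (2 * d) j s t a b c e Lj D0.

Lemma cut_cases : two j \/ mid j \/ 2 * d <= 3 * X j j.
Proof.
have := prof_cut prof j; have := prof_even prof j evend.
by rewrite /two /mid; lia.
Qed.

(** All but 2 edges across [j] are counted by [X j.-2 j] or [X j (j + 1)], and all but 2 by
    [X j.-1 j] or [X j (j + 2)]. A weight 2 on the nearest gap only helps, because more edges reach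
    it. *)
Lemma coverage_five w : w <= W j -> good_pair j.-1 j.-2 -> good_pair (j + 1) (j + 2) ->
  w * X j j + 2 * X j j - 4 <= coverage L X W (2 * d) j.
Proof.
move=> wj; rewrite /good_pair => gl gr.
have r1 := hRect j.-2 j (j + 1).
have r2 := hRect j.-1 j (j + 2).
have h1 := prof_homol prof j.-2 j.-1 j.
have h2 := prof_homor prof j (j + 1) (j + 2).
have {}r1 : X j j <= X j.-2 j + X j (j + 1) + 2 by lia.
have {}r2 : X j j <= X j.-1 j + X j (j + 2) + 2 by lia.
have {}h1 : X j.-2 j <= X j.-1 j by lia.
have {}h2 : X j (j + 2) <= X j (j + 1) by lia.
case: (ltnP 1 (W j.-1)) gl => [l2 _|l1 /= l0]; case: (ltnP 1 (W (j + 1))) gr => [r22 _|r11 /= r0].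
- apply: leq_trans (cov (s := [:: (2, j.-1); (w, j)]) (t := [:: (2, j + 1)]) _ _ _ _);
    try by rewrite /= ?inE; lia.
  by rewrite !big_cons !big_nil /=; lia.
- apply: leq_trans (cov (s := [:: (2, j.-1); (w, j)]) (t := [:: (1, j + 1); (1, j + 2)]) _ _ _ _);
    try by rewrite /= ?inE; lia.
  by rewrite !big_cons !big_nil /=; lia.
- apply: leq_trans (cov (s := [:: (1, j.-2); (1, j.-1); (w, j)]) (t := [:: (2, j + 1)]) _ _ _ _);
    try by rewrite /= ?inE; lia.
  by rewrite !big_cons !big_nil /=; lia.
- apply: leq_trans (cov (s := [:: (1, j.-2); (1, j.-1); (w, j)]) (t := [:: (1, j + 1); (1, j + 2)]) _ _ _ _);
    try by rewrite /= ?inE; lia.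
  by rewrite !big_cons !big_nil /=; lia.
Qed.

Lemma coverage_self w : w <= W j -> w * X j j <= coverage L X W (2 * d) j.
Proof.
move=> wj; apply: leq_trans (cov (s := [:: (w, j)]) (t := [::]) _ _ _ _);
    try by rewrite /= ?inE; lia.
by rewrite !big_cons !big_nil /=; lia.
Qed.

Lemma coverage_three : 0 < W j.-1 -> 0 < W j -> 0 < W (j + 1) ->
  2 * X j j - 1 <= coverage L X W (2 * d) j.
Proof.
move=> w1 w2 w3.
apply: leq_trans (cov (s := [:: (1, j.-1); (1, j)]) (t := [:: (1, j + 1)]) _ _ _ _);
    try by rewrite /= ?inE; lia.
rewrite !big_cons !big_nil /=.
by have := hRect j.-1 j (j + 1); lia.
Qed.

Lemma coverage_zone s o z : L <= s -> j = s + o -> 3 <= o < 4 + z ->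
  3 * X s s < 2 * d -> z <= d - 6 -> 8 <= d -> 0 < W (s + 2) -> 0 < W (s + 3) ->
  0 < W (s + (4 + z)) -> 0 < W (s + (5 + z)) ->
  2 * d - 4 <= coverage L X W (2 * d) j.
Proof.
move=> Ls js oz me zd d8 W2 W3 W4 W5.
apply: leq_trans (cov (s := [:: (1, s + 2); (1, s + 3)])
  (t := [:: (1, s + (4 + z)); (1, s + (5 + z))]) _ _ _ _);
  try by rewrite /= ?inE; lia.
rewrite !big_cons !big_nil /=.
have := hRect (s + 3) j (s + (4 + z)).
have := hRect (s + 2) j (s + (5 + z)).
have := @block_cut s j Ls.
have -> : j - s = o by lia.
have -> : j - (s + 3) = o - 3 by lia.
have -> : j - (s + 2) = o - 2 by lia.
have -> : s + (4 + z) - j = 4 + z - o by lia.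
have -> : s + (5 + z) - j = 5 + z - o by lia.
move=> b1 b2 b3.
have {}b1 : o * (d + 1 - o) <= X j j + X s s by lia.
have {}b2 : X j j <= X (s + 2) j + X j (s + (5 + z)) + (o - 2) * (5 + z - o) by lia.
have {}b3 : X j j <= X (s + 3) j + X j (s + (4 + z)) + (o - 3) * (4 + z - o) by lia.
(* The right side exceeds the left one by [2 (o - 3) (d - 6 - z)]; this is where a zone must not be
   longer than [d - 6]. *)
have key : (o - 2) * (5 + z - o) + (o - 3) * (4 + z - o) + 6 * d
    <= 2 * (o * (d + 1 - o)) + 14 + z.
  by clear -oz zd d8; nia.
by clear -b1 b2 b3 key me zd d8; lia.
Qed.

(** The cut is at least [2 d / 3], so [coverage_five] applies once both sides have two units of
    weight. What could spoil this, a 2-cut shortly after [j] or a [mid] tile before it, makes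
    [X j j] so large that less weight suffices. *)
Lemma coverage_single : tstart j -> ~~ two j -> ~~ two (j + 2) -> ~~ mid j ->
  2 * d - 4 <= coverage L X W (2 * d) j.
Proof.
move=> rs n1 n2 n3; have Wj := W_pos rs n1 n2.
have [big|small] := leqP (2 * d - 4) (X j j).
  by have := coverage_self Wj; rewrite mul1n; apply: leq_trans.
have e3 : 2 * d <= 3 * X j j.
  by case: cut_cases => [t|[m|//]]; [rewrite t in n1 | rewrite m in n3].
have n4 : ~~ two (j + 1) := no_two_next rs.
have n5 : ~~ two (j + 1 + 2).
  apply/negP => t; have := two_lt t => lt.
  have := hL (j + 3) (j + 3) j j; move: t; rewrite /two -addnA => /eqP->.
  have -> : j + 3 - j = 3 by lia.
  by clear -small lt jn d6 L0; nia.
have n6 : ~~ two (j + 1 + 3).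
  apply/negP => t; have := two_lt t => lt.
  have := hL (j + 4) (j + 4) j j; move: t; rewrite /two -addnA => /eqP->.
  have -> : j + 4 - j = 4 by lia.
  by clear -small lt jn d6 L0; nia.
have rs1 := tile_startS rs; rewrite tile_single //= in rs1.
have gr := right_good rs1 n4 n5 n6; rewrite -addnA in gr.
have Lj1 : L + 1 < j by clear -jn d6; lia.
case: (leftP rs Lj1 n1 n2) => [gl|t Lt mt jt|t Lt mt jt Wp].
- by have := coverage_five Wj gl gr; clear -e3; lia.
- have [z0 zd d8 _] := zone_bounds Lt mt; have ez : extra t <= zone t by apply: leq_addr.
  have := @block_cut t j Lt; have -> : j - t = 4 + zone t by clear -jt; lia.
  move: mt; rewrite /mid; clear -z0 zd d8 ez jt jn small; nia.
- have [z0 zd d8 _] := zone_bounds Lt mt; have ez : extra t <= zone t by apply: leq_addr.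
  have ej : d <= X j j.
    have := @block_cut t j Lt; have -> : j - t = 5 + zone t by clear -jt; lia.
    move: mt; rewrite /mid; clear -z0 zd d8 ez jt jn small; nia.
  have Wn : 0 < W (j + 1) by move: gr; rewrite /good_pair; clear; lia.
  by have := coverage_three Wp Wj Wn; clear -ej; lia.
Qed.

Lemma coverage_mid s o : tstart s -> ~~ two s -> ~~ two (s + 2) -> mid s ->
  j = s + o -> o < 4 + zone s -> 2 * d - 4 <= coverage L X W (2 * d) j.
Proof.
move=> rs n1 n2 m js os; have Ls := tile_start_ge rs.
have [x0 zd d8 zs] := zone_bounds Ls m.
have xz : extra s <= zone s by apply: leq_addr.
have me : 4 <= X s s /\ 3 * X s s < 2 * d by apply/andP.
have Wo := W_tile rs; rewrite tile_mid //= size_nseq in Wo.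
have W0 : W s = 1 + extra s by rewrite -[s]addn0 Wo ?addn0.
have W1 := Wo 1 isT; have W2 : W (s + 2) = 1 := Wo 2 isT; have W3 : W (s + 3) = 1 := Wo 3 isT.
rewrite /= in W1; clear Wo.
have n3 : ~~ two (s + 1) := no_two_next rs.
have [ o0|[ o1|[ o2|o3]]] : o = 0 \/ o = 1 \/ o = 2 \/ 3 <= o by clear; lia.
- move: js; rewrite o0 addn0 => js; subst s.
  have [low|semi] := ltnP (2 * X j j) d.
    have Wj : d./2 - 1 <= W j by move: W0; rewrite /extra low; clear -d8; lia.
    have := coverage_self Wj; clear -me d8 evend low; nia.
  have Lj1 : L + 1 < j by clear -jn d6; lia.
  have gl : good_pair j.-1 j.-2.
    case: (leftP rs Lj1 n1 n2) => [//|t Lt mt jt|t Lt mt jt Wp].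
    + have [_ zt _ _] := zone_bounds Lt mt; have := mid_mid Lt mt m.
      by clear -jt d8 zt; lia.
    + have [_ zt _ _] := zone_bounds Lt mt; have := mid_mid Lt mt m.
      by clear -jt d8 zt; lia.
  have gr : good_pair (j + 1) (j + 2) by rewrite /good_pair W1 W2 orbT.
  have Wj : 2 <= W j by clear -W0 x0; lia.
  by have := coverage_five Wj gl gr; clear -semi; lia.
- rewrite o1 in js; rewrite -js in n3 W1.
  have gl : good_pair j.-1 j.-2 by rewrite js addn1 /= /good_pair W0 add1n ltnS x0.
  have gr : good_pair (j + 1) (j + 2) by rewrite js -!addnA /good_pair W2 W3.
  case: (boolP (mid j)) W1 => [mj|nm] W1.
    have me1 : 4 <= X j j /\ 3 * X j j < 2 * d by apply/andP.
    have [low|semi] := ltnP (2 * X j j) d.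
      have Wj : d./2 - 1 <= W j by rewrite W1 /extra low; clear -d8; lia.
      have := coverage_self Wj; clear -me1 d8 evend low; nia.
    have Wj : 2 <= W j by rewrite W1 /extra [2 * _ < _]ltnNge semi.
    by have := coverage_five Wj gl gr; clear -semi; lia.
  have Wj : 1 <= W j by rewrite W1.
  have := coverage_five Wj gl gr.
  case: cut_cases => [t|[mm|]]; [by rewrite t in n3 | by rewrite mm in nm | by clear; lia].
- rewrite o2 in js.
  have w1 : 0 < W j.-1 by rewrite (_ : j.-1 = s + 1) ?W1 //; clear -js; lia.
  have w2 : 0 < W j by rewrite js W2.
  have w3 : 0 < W (j + 1) by rewrite js -addnA W3.
  have := coverage_three w1 w2 w3.
  have := @block_cut s j Ls; have -> : j - s = 2 by clear -js; lia.
  clear -me js jn d8; nia.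
- have ru := tile_startS rs; rewrite size_tile_mid // in ru.
  have nu1 : ~~ two (s + (4 + zone s)).
    by apply/negP => t; have := mid_two Ls m t; clear -zd d8; lia.
  have nu2 : ~~ two (s + (4 + zone s) + 2).
    by apply/negP => t; have := mid_two Ls m t; clear -zd d8; lia.
  (* Here the distance from [s] is [7 + zone s]: it is at most [d] if [zone s <= d - 7], and
     otherwise the [mid] cut at [s + 1] is one place nearer. *)
  have nu3 : ~~ two (s + (4 + zone s) + 3).
    apply/negP => t; case/orP: zs => [m1|z7].
      by have := mid_two (leq_trans Ls (leq_addr 1 s)) m1 t; clear -zd d8; lia.
    by have := mid_two Ls m t; clear -z7 d8; lia.
  have Wu : 0 < W (s + (4 + zone s)) := W_pos ru nu1 nu2.
  have Wu1 : 0 < W (s + (5 + zone s)).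
    have nm : ~~ mid (s + (4 + zone s)).
      by apply/negP => mu; have := mid_mid Ls m mu; clear -zd d8; lia.
    have ru1 := tile_startS ru; rewrite tile_single //= in ru1.
    have := W_pos ru1 (no_two_next ru); rewrite -[_ + 1 + 2]addnA => /(_ nu3).
    by rewrite -addnA (addnC (4 + _)) addnA.
  apply: (coverage_zone (s := s) (o := o) (z := zone s)); rewrite ?W2 ?W3 //.
  + by rewrite o3 os.
  + by case: me.
Qed.

Lemma weight_before_two s : tstart s -> L < s -> two s -> W s.-1 = 2.
Proof.
move=> rs Ls ts; have [t [rt st tp Wt]] := tile_prev even_tile_gt0 rs Ls.
rewrite -/W in Wt; rewrite Wt; clear Wt.
have Lt := tile_start_ge rt.
case: (tileP t) => [t1 t2|t1 t2|t1 t2|t1 t2 t3|t1 t2 t3].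
- have sd : s = t + d by rewrite {1}st size_tile_chain.
  by have := two_two (ltnW Ls) ts t2; clear -sd d6; lia.
- by rewrite tile_two //= last_rcons.
- by rewrite tile_before.
- have sd : s = t + (4 + zone t) by rewrite {1}st size_tile_mid.
  have [_ zt _ _] := zone_bounds Lt t3; have := mid_two Lt t3 ts.
  by clear -zt d6 sd; lia.
- have sd : s = t + 1 by rewrite {1}st tile_single.
  by have := no_two_next rt; rewrite -sd ts.
Qed.

Lemma coverage_cut2 s : tstart s -> two s -> j = s -> W s = d - 3 -> W (s + 1) = 2 ->
  2 * d - 4 <= coverage L X W (2 * d) j.
Proof.
move=> rs ts js W0 W1; subst s.
have Lj : L < j by clear -jn d6; lia.
have Wp := weight_before_two rs Lj ts.
apply: leq_trans (cov (s := [:: (2, j.-1); (d - 3, j)]) (t := [:: (2, j + 1)]) _ _ _ _);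
  try by rewrite /= ?inE; clear -jn d6 Wp W0 W1; lia.
rewrite !big_cons !big_nil /=.
have := hRect j.-1 j (j + 1); move: ts; rewrite /two => /eqP ->.
by clear -jn d6; lia.
Qed.

(** The weights 2 at [s + 1] and [s + d + 1] give at least [2 (d - 1 - o) + 2 (o - 3) = 2 d - 8].
    The missing 4 comes from the weight 1 halfway between the two 2-cuts. *)
Lemma coverage_chain s o : tstart s -> two s -> two (s + d + 2) ->
  j = s + o -> 2 <= o <= d -> 2 * d - 4 <= coverage L X W (2 * d) j.
Proof.
move=> rs ts ts2 js od; have Ls := tile_start_ge rs.
have lt := two_lt ts2.
have W1 : W (s + 1) = 2 by rewrite W_tile // ?size_tile_chain ?tile_chain //; clear -d6; lia.
have Wm : W (s + (d./2 + 1)) = 1.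
  rewrite W_tile // ?size_tile_chain ?tile_chain //; last by clear -d6; lia.
  rewrite (_ : d./2 + 1 = (d./2).-1.+2) /=; last by clear -d6; lia.
  rewrite nth_cat size_nseq.
  have -> : (d./2).-1 < d./2 - 1 = false by clear; lia.
  by have -> : (d./2).-1 - (d./2 - 1) = 0 by clear; lia.
have We : W (s + (d + 1)) = 2.
  have ru := tile_startS rs; rewrite size_tile_chain // in ru.
  have nu : ~~ two (s + d).
    by apply/negP => t; have := two_two Ls ts t; clear -d6; lia.
  by rewrite addnA W_tile // ?tile_before.
have /eqP e0 := ts; have /eqP e2 := ts2.
have b1 := hR s s (s + 1) j; have b2 := hR s s j (s + (d./2 + 1)).
have b3 := hL (s + d + 2) (s + d + 2) (s + (d + 1)) j.
have b4 := hL (s + d + 2) (s + d + 2) j (s + (d./2 + 1)).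
rewrite e0 in b1 b2; rewrite e2 in b3 b4.
have E1 : s + 1 - s = 1 by clear; lia.
have E2 : d + 1 - (j - s) = d + 1 - o by clear -js; lia.
have E3 : j - s = o by clear -js; lia.
have E4 : d + 1 - (s + (d./2 + 1) - s) = d./2 by clear -evend; lia.
have E5 : s + d + 2 - (s + (d + 1)) = 1 by clear; lia.
have E6 : d + 1 - (s + d + 2 - j) = o - 1 by clear -js od; lia.
have E7 : s + d + 2 - j = d + 2 - o by clear -js od; lia.
have E8 : d + 1 - (s + d + 2 - (s + (d./2 + 1))) = d./2 by clear -evend; lia.
rewrite E1 E2 in b1; rewrite E3 E4 in b2; rewrite E5 E6 in b3; rewrite E7 E8 in b4.
have {}b1 : d + 1 - o <= X (s + 1) j + 2 by clear -b1 js od lt Ls; lia.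
have {}b3 : o - 1 <= X j (s + (d + 1)) + 2.
  by clear -b3 js od lt Ls; lia.
case: (ltnP o (d./2 + 1)) => [ om|om].
- apply: leq_trans (cov (s := [:: (2, s + 1)])
    (t := [:: (1, s + (d./2 + 1)); (2, s + (d + 1))]) _ _ _ _);
    try by rewrite /= ?inE; clear -jn d6 Wm W1 We js od om Ls; lia.
  rewrite !big_cons !big_nil /=.
  have {}b2 : o * d./2 <= X j (s + (d./2 + 1)) + 2 by clear -b2 js od lt Ls om; lia.
  have b5 : 2 * d./2 <= o * d./2 by rewrite leq_mul2r; clear -od; lia.
  by clear -b1 b2 b3 b5 d6 evend od; lia.
- apply: leq_trans (cov (s := [:: (2, s + 1); (1, s + (d./2 + 1))])
    (t := [:: (2, s + (d + 1))]) _ _ _ _);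
    try by rewrite /= ?inE; clear -jn d6 Wm W1 We js od om Ls; lia.
  rewrite !big_cons !big_nil /=.
  have {}b4 : (d + 2 - o) * d./2 <= X (s + (d./2 + 1)) j + 2.
    by clear -b4 js od lt Ls om; lia.
  have b5 : 2 * d./2 <= (d + 2 - o) * d./2 by rewrite leq_mul2r; clear -od; lia.
  by clear -b1 b4 b3 b5 d6 evend od; lia.
Qed.

Lemma coverage_gap1 s : tstart s -> two s -> j = s + 1 -> W (s + 1) = 2 ->
  2 * d - 4 <= coverage L X W (2 * d) j.
Proof.
move=> rs ts js W1; have Ls := tile_start_ge rs.
have Wj : 2 <= W j by rewrite js W1.
have := coverage_self Wj; have := @block_cut s j Ls.
move: ts; rewrite /two => /eqP ->; have -> : j - s = 1 by clear -js; lia.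
by clear -js jn d6; lia.
Qed.

Lemma coverage_tile_chain s o : tstart s -> two s -> two (s + d + 2) ->
  j = s + o -> o < d -> 2 * d - 4 <= coverage L X W (2 * d) j.
Proof.
move=> rs ts ts2 js od.
have W0 : W s = d - 3 by rewrite W_head // tile_chain.
have W1 : W (s + 1) = 2 by rewrite W_tile // ?size_tile_chain ?tile_chain //; clear -d6; lia.
have [ o0|[ o1|o2]] : o = 0 \/ o = 1 \/ 2 <= o by clear; lia.
- by apply: (coverage_cut2 rs); rewrite // js o0 addn0.
- by apply: (coverage_gap1 rs); rewrite // js o1.
- by apply: (coverage_chain rs ts ts2 js); rewrite o2 ltnW.
Qed.

Lemma coverage_tile_two s o : tstart s -> two s -> ~~ two (s + d + 2) ->
  j = s + o -> o <= d -> 2 * d - 4 <= coverage L X W (2 * d) j.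
Proof.
move=> rs ts ts2 js od; have Ls := tile_start_ge rs.
have W0 : W s = d - 3 by rewrite W_head // tile_two.
have W1 : W (s + 1) = 2 by rewrite W_tile // ?size_tile_two ?tile_two //; clear -d6; lia.
have Wd : W (s + d) = 2.
  rewrite W_tile // ?size_tile_two ?tile_two ?addn1 //.
  have -> : d = (d - 2).+2 by clear -d6; lia.
  by rewrite /= subn2 /= nth_rcons size_nseq ltnn eqxx.
have /eqP e0 := ts.
have [ o0|[ o1|[ o2|o3]]] : o = 0 \/ o = 1 \/ 2 <= o < d \/ o = d by clear -od; lia.
- by apply: (coverage_cut2 rs); rewrite // js o0 addn0.
- by apply: (coverage_gap1 rs); rewrite // js o1.
- apply: leq_trans (cov (s := [:: (2, s + 1)]) (t := [:: (2, s + d)]) _ _ _ _);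
    try by rewrite /= ?inE; clear -jn d6 W1 Wd js o2 Ls; lia.
  rewrite !big_cons !big_nil /=.
  have := hR s s (s + 1) j; have := hR s (s + 1) j (s + d).
  rewrite e0.
  have -> : s + 1 - s = 1 by clear; lia.
  have -> : j - s = o by clear -js; lia.
  have -> : j - (s + 1) = o - 1 by clear -js; lia.
  have -> : d + 1 - (s + d - s) = 1 by clear; lia.
  by clear -js o2 jn d6 Ls; lia.
- have Wj : 2 <= W j by rewrite js o3 Wd.
  have := coverage_self Wj; have := @block_cut s j Ls.
  rewrite e0; have -> : j - s = d by clear -js o3; lia.
  by clear -js jn d6; lia.
Qed.

Lemma coverage_tile_before s o : tstart s -> ~~ two s -> two (s + 2) ->
  j = s + o -> o < 2 -> 2 * d - 4 <= coverage L X W (2 * d) j.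
Proof.
move=> rs ns ts js o2; have Ls := tile_start_ge rs.
have /eqP e2 := ts; have lt := two_lt ts.
have W1 : W (s + 1) = 2 by rewrite W_tile // tile_before.
have [ o0|o1] : o = 0 \/ o = 1 by clear -o2; lia.
- move: js; rewrite o0 addn0 => js; subst s.
  have Lj : L < j by clear -jn d6; lia.
  have [t [rt st tp Wt]] := tile_prev even_tile_gt0 rs Lj; rewrite -/W in Wt.
  have Lt := tile_start_ge rt.
  (* Only a chain tile leaves weight 0 before [j]; then [j] is treated as offset [d] of that
     tile. *)
  have [[t1 t2]|Wp] : (two t /\ two (t + d + 2)) \/ 0 < W j.-1; last first.
  + apply: leq_trans (cov (s := [:: (1, j.-1)]) (t := [:: (2, j + 1)]) _ _ _ _);
      try by rewrite /= ?inE; clear -jn d6 W1 Wp; lia.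
    rewrite !big_cons !big_nil /=.
    have := hL (j + 2) (j + 2) (j + 1) j; have := hL (j + 2) (j + 2) j j.-1.
    rewrite e2.
    have -> : j + 2 - (j + 1) = 1 by clear; lia.
    have -> : j + 2 - j = 2 by clear; lia.
    have -> : j + 2 - j.-1 = 3 by clear -Lj; lia.
    by clear -jn d6 lt; lia.
  + have jt : j = t + d by rewrite {1}st size_tile_chain.
    by apply: (coverage_chain rt t1 t2 jt); clear -d6; lia.
  + case: (tileP t) => [t1 t2|t1 t2|t1 t2|t1 t2 t3|t1 t2 t3].
    * by left.
    * by right; rewrite Wt tile_two //= last_rcons.
    * by right; rewrite Wt tile_before.
    * have sd : j = t + (4 + zone t) by rewrite {1}st size_tile_mid.
      have [_ zt _ _] := zone_bounds Lt t3; have := mid_two Lt t3 ts.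
      by clear -zt d6 sd; lia.
    * by right; rewrite Wt tile_single.
- have Wj : 2 <= W j by rewrite js o1 W1.
  have := coverage_self Wj; have := hL (s + 2) (s + 2) j j.
  rewrite e2; have -> : s + 2 - j = 1 by clear -js o1; lia.
  by clear -js o1 jn d6 lt; lia.
Qed.

End Gap.

Lemma even_coverage j : L + 2 * d <= j < n ->
  2 * d - 4 <= coverage L X W (2 * d) j.
Proof.
move=> jn; have Lj : L <= j by clear -jn; lia.
have [s [ o [rs js os]]] := tile_cover even_tile_gt0 Lj.
case: (tileP s) => [t1 t2|t1 t2|t1 t2|t1 t2 t3|t1 t2 t3].
- by rewrite size_tile_chain // in os; apply: (coverage_tile_chain jn rs t1 t2 js).
- rewrite size_tile_two // addn1 ltnS in os.
  exact: (coverage_tile_two jn rs t1 t2 js).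
- by rewrite tile_before // in os; apply: (coverage_tile_before jn rs t1 t2 js).
- by rewrite size_tile_mid // in os; apply: (coverage_mid jn rs t1 t2 t3 js).
- rewrite tile_single //= ltnS leqn0 in os; move: js; rewrite (eqP os) addn0 => js.
  by subst s; apply: coverage_single.
Qed.

Lemma even_dual_weights_from : dual_weights n L X (2 * d - 4) (2 * d) W.
Proof.
split; last exact: even_coverage.
by move=> m Lm; apply: (weight_sum_le even_tile_gt0 even_tile_le even_tile_sum).
Qed.

End Even.

(** * Weights for all degrees *)

Lemma profile_from n L L' d X : L <= L' -> profile n L d X -> profile n L' d X.
Proof.
move=> LL [h1 h2 h3 h4 h5 h6 h7 h8 h9]; split => //.
- by move=> I S k m LS; apply: h3; apply: leq_trans LS.
- by move=> I S k m Lk; apply: h4; apply: leq_trans Lk.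
- by move=> i /andP[Li ?]; apply: h6; rewrite (leq_trans LL).
- by move=> i ev Li; apply: h9 => //; apply: leq_trans Li.
Qed.

Lemma dual_weights_widen n L L' X c D D' W : L <= L' -> L' + D <= L + D' ->
  dual_weights n L' X c D W ->
  dual_weights n L X c D' (fun i => if i < L' then 0 else W i).
Proof.
move=> LL DD [sumW covW].
set W' := fun i => _.
have W0 b f : b <= L' -> \sum_(L <= i < b) W' i * f i = 0.
  move=> bL; rewrite big_nat; apply: big1 => i ib.
  by rewrite /W' ifT //; lia.
have W1 b f : \sum_(L' <= i < b) W' i * f i = \sum_(L' <= i < b) W i * f i.
  by apply: eq_big_nat => i ib; rewrite /W' ifF //; lia.
split=> [m Lm|j jn].
  under eq_bigr do rewrite -[W' _]muln1.
  have [mL'|L'm] := leqP m L'; first by rewrite W0 //.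
  rewrite (@big_cat_nat _ _ _ L') //= ?(ltnW L'm) // W0 // W1.
  under eq_bigr do rewrite muln1.
  by have := sumW m (ltnW L'm); lia.
have jn' : L' + D <= j < n by lia.
apply: leq_trans (covW j jn') _; rewrite /coverage.
rewrite [leqRHS](@big_cat_nat _ _ _ L') //=; last by lia.
rewrite W0 // W1 [leqRHS](@big_cat_nat _ _ _ (j + D)) //=; [exact: leq_addr | lia | lia].
Qed.

Lemma dual_weights_exist n L d X : 3 <= d -> 0 < L -> profile n L d X ->
  exists W, dual_weights n L X (if odd d then d - 1 else 2 * d - 4) (2 * d + 1) W.
Proof.
move=> d3 L0 prof.
have widen L' c W : L <= L' <= L + 1 -> dual_weights n L' X c (2 * d) W ->
    exists W, dual_weights n L X c (2 * d + 1) W.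
  move=> LL dW; exists (fun i => if i < L' then 0 else W i).
  by apply: dual_weights_widen dW; lia.
case: ifP => [ od|/negbT ev].
  by have [W dW] := odd_dual_weights d3 od L0 prof; apply: widen dW; lia.
have [d4|d6] : d = 4 \/ 6 <= d by lia.
  subst d; have [W dW] := four_dual_weights L0 prof; apply: widen dW; lia.
(* The gaps [L + 1] and [L + 2] are too close to be both 2-cuts, so starting at [L + 1] secures the
   hypothesis [two_L]. The later start costs the 1 in [2 * d + 1]. *)
case: (boolP (two X (L + 1))) => [t|nt]; last first.
  by apply: widen (even_dual_weights_from d6 ev L0 prof nt); lia.
have prof1 := profile_from (leq_addr 1 L) prof.
have nt : ~~ two X (L + 1 + 1).
  apply/negP => t2; have := two_two d6 ev L0 prof (leq_addr 1 L) t t2; lia.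
apply: widen (even_dual_weights_from d6 ev _ prof1 nt); lia.
Qed.

(** * Edges across the gaps *)

Section Crossing.
Variables (n L d : nat) (E : nat -> nat -> bool).
Hypotheses (E_sym : symmetric E) (E_irr : irreflexive E).
Hypothesis E_cut : forall i, 0 < i < n -> exists a b, a < i <= b /\ b < n /\ E a b.
Hypothesis E_deg : forall a, L <= a < n -> \sum_(0 <= b < n) E a b = d.

Definition crossing i j := \sum_(0 <= a < i) \sum_(j <= b < n) E a b.

Let up a j := \sum_(j <= b < n) E a b.
Let down a i := \sum_(0 <= b < i) E a b.

Lemma crossing_cat S k m : S <= k ->
  crossing k m = crossing S m + \sum_(S <= a < k) up a m.
Proof. by move=> Sk; rewrite /crossing (@big_cat_nat _ _ _ S). Qed.

Lemma crossing_catr I S k : S <= k <= n ->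
  crossing I S = \sum_(S <= a < k) down a I + crossing I k.
Proof.
move=> /andP[Sk kn]; rewrite /down exchange_big_nat -big_split /=.
by apply: eq_bigr => a _; rewrite (@big_cat_nat _ _ _ k) //=;
  congr (_ + _); apply: eq_bigr => b _; rewrite E_sym.
Qed.

Lemma up_le a k m : k <= m -> up a k <= up a m + (m - k).
Proof.
move=> km; have sz u v : \sum_(u <= b < v) E a b <= v - u.
  rewrite -[v - u]muln1 -sum_nat_const_nat; apply: leq_sum => b _.
  by case: (E a b).
have [mn|nm] := leqP m n.
  rewrite /up (@big_cat_nat _ _ _ m) //= addnC leq_add2l; exact: sz.
by rewrite (leq_trans (sz _ _)) // (leq_trans _ (leq_addl _ _)) // leq_sub2r // ltnW.
Qed.

Lemma degree_split a I m : L <= a < n -> I <= a < m ->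
  d + 1 - (m - I) <= down a I + up a m.
Proof.
move=> an /andP[Ia am]; have an' : a < n by lia.
have := E_deg an; rewrite (@big_cat_nat _ _ _ a.+1) //=.
rewrite big_nat_recr //= E_irr addn0 (@big_cat_nat _ _ _ I) //= => <-.
have h : \sum_(I <= b < a) E a b <= a - I.
  rewrite -[a - I]muln1 -sum_nat_const_nat; apply: leq_sum => b _.
  by case: (E a b).
have := up_le a am; rewrite /up /down; lia.
Qed.

Lemma sum_degree_split S k I m : L <= S -> k <= n -> I <= S -> k <= m ->
  (k - S) * (d + 1 - (m - I)) <=
  \sum_(S <= a < k) down a I + \sum_(S <= a < k) up a m.
Proof.
move=> LS kn IS km; rewrite -sum_nat_const_nat -big_split /=.
rewrite big_nat [leqRHS]big_nat; apply: leq_sum => a /andP[Sa ak].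
by apply: degree_split; lia.
Qed.

Lemma crossing_homol i i' j : i <= i' -> crossing i j <= crossing i' j.
Proof. by move=> ii; rewrite [leqRHS](crossing_cat j ii) leq_addr. Qed.

Lemma crossing_homor i j j' : j <= j' -> crossing i j' <= crossing i j.
Proof.
move=> jj; have [jn|nj] := leqP j' n.
  by rewrite [leqRHS](@crossing_catr _ _ j') ?jj // leq_addl.
by rewrite {1}/crossing big1 // => a _; rewrite big_geq // ltnW.
Qed.

Lemma crossing_step i : L <= i < n ->
  crossing i i + crossing i.+1 i.+1 = d + 2 * crossing i i.+1.
Proof.
move=> iL; have [Li lin] := andP iL.
rewrite (@crossing_catr i i i.+1) ?leqnSn // (crossing_cat i.+1 (leqnSn i)).
have := E_deg iL; rewrite (@big_cat_nat _ _ _ i.+1) //= big_nat_recr //= E_irr.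
by rewrite !big_nat1 /up /down; lia.
Qed.

Lemma crossing_top i j : n <= j -> crossing i j = 0.
Proof. by move=> nj; apply: big1 => a _; rewrite big_geq. Qed.

(** By [crossing_step], adjacent cuts have the same parity when [d] is even; the induction descends
    from [n], where the cut is empty. *)
Lemma crossing_even i : ~~ odd d -> L <= i -> ~~ odd (crossing i i).
Proof.
move=> dev; have [k] := ubnP (n - i).
elim: k i => // k IH i ik Li; have [ni|lin] := leqP n i.
  by rewrite crossing_top.
have /crossing_step h : L <= i < n by rewrite Li.
have := IH i.+1; lia.
Qed.

Lemma crossing_profile : profile n L d crossing.
Proof.
split.
- exact: crossing_homol.
- exact: crossing_homor.
- move=> I S k m LS /andP[IS Sk] km kn.
  rewrite (crossing_cat m Sk) (@crossing_catr I S k) ?Sk //.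
  have := crossing_homol m IS; have := sum_degree_split LS kn IS km; lia.
- move=> I S k m Lk /andP[mk kS] SI In.
  rewrite (crossing_cat I kS) (@crossing_catr m k S) ?kS ?(leq_trans SI) //.
  have := crossing_homor m SI.
  have := sum_degree_split Lk (leq_trans SI In) mk SI; lia.
- move=> S k m /andP[Sk km].
  rewrite (crossing_cat k Sk) (crossing_cat m Sk) [_ + crossing S m]addnC.
  suff : \sum_(S <= a < k) up a k <= \sum_(S <= a < k) up a m + (k - S) * (m - k) by lia.
  by rewrite -sum_nat_const_nat -big_split leq_sum // => a _; exact: up_le.
- exact: crossing_step.
- exact: crossing_top.
- move=> i lin; have [a [b [/andP[ai ib] [bn Eab]]]] := E_cut lin.
  rewrite /crossing (@big_cat_nat _ _ _ a) //= ?(ltnW ai) //.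
  rewrite [X in _ + X]big_ltn // [X in _ + (X + _)](@big_cat_nat _ _ _ b) //= ?(ltnW bn) //.
  by rewrite [X in _ + (_ + X + _)]big_ltn // Eab; lia.
- exact: crossing_even.
Qed.

End Crossing.

Local Open Scope classical_set_scope.
Local Open Scope ring_scope.

(** * Summation by parts *)

Section AbelSummation.
Variable R : realFieldType.

Lemma abel_weights (W : nat -> nat) (psi : nat -> R) (L D n : nat) :
  (forall m, L <= m -> \sum_(L <= i < m) W i <= m - L + D)%N ->
  (forall i, 0 <= psi i) -> (forall i, psi i.+1 <= psi i) -> (L <= n)%N ->
  \sum_(L <= i < n) (W i)%:R * psi i <= \sum_(L <= i < n) psi i + D%:R * psi L.
Proof.
move=> sumW psi0 psid.
suff h m : \sum_(L <= i < L + m) (W i)%:R * psi i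
    + ((m + D)%:R - (\sum_(L <= i < L + m) W i)%:R) * psi (L + m)%N
    <= \sum_(L <= i < L + m) psi i + D%:R * psi L.
  move=> Ln; have := h (n - L)%N; rewrite subnKC //; apply: le_trans.
  rewrite lerDl mulr_ge0 // subr_ge0 ler_nat; have := sumW n Ln; lia.
elim: m => [|m IH]; first by rewrite addn0 !big_geq // subr0 add0n add0r.
rewrite addnS !big_nat_recr ?leq_addr //=.
have := sumW (L + m).+1 (leqW (leq_addr m L)).
rewrite big_nat_recr ?leq_addr //= -addnS addKn => h.
have {}h : 0 <= (m.+1 + D)%:R - (\sum_(L <= i < L + m) W i + W (L + m))%:R :> R.
  by rewrite subr_ge0 ler_nat.
have := ler_wpM2l h (psid (L + m)%N).
move: IH; rewrite -addnS !natrD -(natr1 m); nra.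
Qed.

Lemma sum_by_parts (x psi : nat -> R) q n : (0 < q <= n)%N ->
  \sum_(q <= j < n) (x j - x j.-1) * psi j =
  \sum_(q <= j < n) x j * (psi j - psi j.+1) + x n.-1 * psi n - x q.-1 * psi q.
Proof.
move=> /andP[q0 /subnKC <-]; elim: (n - q)%N => [|k IH].
  by rewrite addn0 !big_geq //; lra.
rewrite addnS !big_nat_recr ?leq_addr //= IH; lra.
Qed.

Lemma sum_tails (x phi : nat -> R) L n : (L <= n)%N ->
  \sum_(L <= i < n) phi i * \sum_(i <= k < n) x k =
  \sum_(L <= k < n) x k * \sum_(L <= i < k.+1) phi i.
Proof.
move/subnKC <-; elim: (n - L)%N => [|k IH]; first by rewrite addn0 !big_geq.
rewrite addnS [RHS]big_nat_recr ?leq_addr //= -IH [LHS]big_nat_recr ?leq_addr //=.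
rewrite big_nat1 [in RHS]big_nat_recr ?leq_addr //= mulrDr addrA [x _ * phi _]mulrC.
congr (_ + _); rewrite mulr_sumr -big_split /=; apply: eq_big_nat => i ik.
by rewrite big_nat_recr /= ?mulrDr 1?[x _ * _]mulrC //; lia.
Qed.

End AbelSummation.

(** * From the weights to a bound on the eigenvalue gap *)

Section Flux.
Variables (R : realFieldType) (n L d : nat) (E : nat -> nat -> bool).
Variables (x : nat -> R) (lam : R).
Hypotheses (E_sym : symmetric E) (E_irr : irreflexive E).
Hypothesis E_cut : forall i, (0 < i < n)%N -> exists a b, (a < i <= b)%N /\ (b < n)%N /\ E a b.
Hypothesis E_le : forall a, (a < n)%N -> (\sum_(0 <= b < n) E a b <= d)%N.
Hypothesis x_ge0 : forall i, 0 <= x i.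
Hypothesis x_homo : forall i j, (i <= j < n)%N -> x i <= x j.
Hypothesis x_sub : forall b, (b < n)%N ->
  d%:R * x b - \sum_(0 <= a < n) (E b a)%:R * x a <= lam * x b.

Let gap j := x j - x j.-1.
Let tail i := \sum_(i <= b < n) x b.
Let flux i := \sum_(0 <= a < i) \sum_(i <= b < n) (E a b)%:R * (x b - x a).

(** The edges with both ends at or above [i] cancel by antisymmetry, so the flux is the Laplacian
    summed over a tail. *)
Lemma flux_tail i : (i <= n)%N -> flux i = \sum_(i <= b < n) \sum_(0 <= a < n) (E b a)%:R * (x b - x a).
Proof.
move=> iln; rewrite /flux exchange_big_nat /=.
under [RHS]eq_bigr do rewrite (@big_cat_nat _ _ _ i) //=.
rewrite big_split /= [X in _ = _ + X](_ : _ = 0) ?addr0.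
  by apply: eq_bigr => b _; apply: eq_bigr => a _; rewrite E_sym.
set S := \sum_(i <= b < n) _; have : S = - S.
  rewrite {1}/S exchange_big_nat /= -sumrN; apply: eq_bigr => b _.
  by rewrite -sumrN; apply: eq_bigr => a _; rewrite E_sym -mulrN opprB.
lra.
Qed.

Lemma flux_le i : (i <= n)%N -> flux i <= lam * tail i.
Proof.
move=> iln; rewrite flux_tail // mulr_sumr big_nat [leRHS]big_nat.
apply: ler_sum => b /andP[_ bn]; apply: le_trans (x_sub bn).
under eq_bigr do rewrite mulrBr; rewrite big_split /= sumrN lerB //.
rewrite -mulr_suml ler_wpM2r // -natr_sum ler_nat; exact: E_le.
Qed.

Lemma gap_sum a b : (a <= b < n)%N ->
  x b - x a = \sum_(1 <= j < n) (a < j <= b)%N%:R * gap j.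
Proof.
move=> /andP[ab bn].
rewrite (@big_cat_nat _ _ _ a.+1) //=; last by lia.
rewrite [X in _ = X + _]big_nat [X in _ = X + _]big1 ?add0r; last first.
  by move=> i im; rewrite (_ : (a < i <= b)%N = false) ?mul0r //; lia.
rewrite (@big_cat_nat _ _ _ b.+1) //=.
rewrite [X in _ = _ + X]big_nat [X in _ = _ + X]big1 ?addr0; last first.
  by move=> i im; rewrite (_ : (a < i <= b)%N = false) ?mul0r //; lia.
rewrite big_nat (eq_bigr (fun i => gap i)); last first.
  by move=> i im; rewrite im mul1r.
rewrite -big_nat big_add1 /= telescope_sumr //.
Qed.

(** An edge difference is the sum of the gaps between its ends, so gap [j] is counted once for each
    edge that crosses both [i] and [j]. *)
Lemma flux_gaps i : (i <= n)%N -> flux i =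
  \sum_(1 <= j < n) gap j * (crossing n E (minn i j) (maxn i j))%:R.
Proof.
move=> iln.
have -> : flux i = \sum_(0 <= a < i) \sum_(i <= b < n) \sum_(1 <= j < n)
    gap j * ((E a b) * (a < j <= b))%N%:R.
  rewrite /flux big_nat [RHS]big_nat; apply: eq_bigr => a /andP[_ ai].
  rewrite big_nat [RHS]big_nat; apply: eq_bigr => b ib.
  rewrite gap_sum; last by lia.
  by rewrite mulr_sumr; apply: eq_bigr => j _; rewrite natrM mulrA mulrC.
under eq_bigr do rewrite exchange_big_nat.
rewrite exchange_big_nat; apply: eq_bigr => j _ /=.
under eq_bigr do rewrite -mulr_sumr.
rewrite -mulr_sumr; congr (_ * _).
under eq_bigr do rewrite -natr_sum.
rewrite -natr_sum; congr (_%:R); rewrite /crossing.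
have [ij|ji] := leqP i j.
  rewrite big_nat [RHS]big_nat.
  apply: eq_bigr => a /andP[_ ai].
  have [jn|nj] := leqP j n; last first.
    rewrite [RHS]big_geq ?(ltnW nj) // big_nat big1 // => b ib.
    by rewrite (_ : (a < j <= b)%N = false) ?muln0 //; lia.
  rewrite (@big_cat_nat _ _ _ j) //= big_nat big1 ?add0n; last first.
    by move=> b ib; rewrite (_ : (a < j <= b)%N = false) ?muln0 //; lia.
  rewrite big_nat [RHS]big_nat; apply: eq_bigr => b ib.
  by rewrite (_ : (a < j <= b)%N = true) ?muln1 //; lia.
rewrite (@big_cat_nat _ _ _ j) ?(ltnW ji) //= [X in (_ + X)%N]big_nat.
rewrite [X in (_ + X)%N]big1 ?addn0; last first.
  move=> a ia; rewrite big1 // => b _.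
  by rewrite (_ : (a < j <= b)%N = false) ?muln0 //; lia.
rewrite big_nat [RHS]big_nat; apply: eq_bigr => a ia.
rewrite big_nat [RHS]big_nat; apply: eq_bigr => b ib.
by rewrite (_ : (a < j <= b)%N = true) ?muln1 //; lia.
Qed.

Lemma gap_ge0 j : (j < n)%N -> 0 <= gap j.
Proof. by move=> jn; rewrite subr_ge0 x_homo // leq_pred. Qed.

Lemma tail_ge0 i : 0 <= tail i.
Proof. exact: sumr_ge0. Qed.

Lemma gap_le_flux j : (0 < j < n)%N -> gap j <= flux j.
Proof.
move=> /andP[j0 jn]; rewrite flux_gaps ?(ltnW jn) //.
have [a [b [/andP[aj jb] [bn Eab]]]] := E_cut (i := j) ltac:(lia).
have c1 : (1 <= crossing n E j j)%N.
  rewrite /crossing (@big_cat_nat _ _ _ a) //= ?(ltnW aj) //.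
  rewrite [X in (_ + X)%N]big_ltn // [X in (_ + (X + _))%N](@big_cat_nat _ _ _ b) //= ?(ltnW bn) //.
  by rewrite [X in (_ + (_ + X + _))%N]big_ltn // Eab; lia.
rewrite (@big_cat_nat _ _ _ j) ?(ltnW jn) //= [X in _ + X]big_ltn // minnn maxnn.
rewrite -[leLHS]add0r lerD //.
  rewrite big_nat; apply: sumr_ge0 => i im; rewrite mulr_ge0 ?ler0n // gap_ge0 //; lia.
rewrite -[leLHS]addr0 lerD //.
  by rewrite ler_peMr ?gap_ge0 // ler1n.
rewrite big_nat; apply: sumr_ge0 => i im; rewrite mulr_ge0 ?ler0n // gap_ge0 //; lia.
Qed.

(** The cut inequalities are added with factors [W i * phi i]. At gap [j] only the terms [i < j + D]
    are used; there [phi i >= phi (j + D)], and the weights have coverage at least [c]. *)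
Lemma flux_weights (c D : nat) W (phi : nat -> R) :
  dual_weights n L (crossing n E) c D W -> 0 <= lam -> (0 < L <= n)%N ->
  (forall i, 0 <= phi i) -> (forall i, phi i.+1 <= phi i) ->
  c%:R * \sum_(L + D <= j < n) gap j * phi (j + D)%N <=
  lam * (\sum_(L <= i < n) phi i * tail i + D%:R * (phi L * tail L)).
Proof.
move=> [sumW covW] lam0 /andP[L0 Ln] phi0 phid.
have phi_le i j : (i <= j)%N -> phi j <= phi i.
  by move/subnKC => <-; elim: (j - i)%N => [|k IH]; rewrite ?addn0 // addnS (le_trans (phid _)).
pose psi i := phi i * tail i.
have psi0 i : 0 <= psi i by rewrite mulr_ge0 ?tail_ge0.
have psid i : psi i.+1 <= psi i.
  rewrite ler_pM ?tail_ge0 //.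
  have [ni|iln] := leqP n i; first by rewrite /tail !big_geq // leqW.
  by rewrite /tail [leRHS]big_ltn // lerDr.
apply: (@le_trans _ _ (lam * \sum_(L <= i < n) (W i)%:R * psi i)); last first.
  by rewrite ler_wpM2l // abel_weights.
apply: (@le_trans _ _ (\sum_(L <= i < n) (W i)%:R * phi i * flux i)); last first.
  rewrite mulr_sumr big_nat [leRHS]big_nat; apply: ler_sum => i /andP[_ iln].
  rewrite [leRHS](_ : _ = (W i)%:R * phi i * (lam * tail i)); last by rewrite /psi; lra.
  by rewrite ler_wpM2l ?flux_le ?mulr_ge0 ?ler0n // ltnW.
rewrite [leRHS](_ : _ = \sum_(1 <= j < n) gap j *
    \sum_(L <= i < n) (W i)%:R * phi i * (crossing n E (minn i j) (maxn i j))%:R); last first.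
  under [RHS]eq_bigr do rewrite mulr_sumr.
  rewrite [RHS]exchange_big_nat /=; apply: eq_big_nat => i /andP[_ iln].
  rewrite flux_gaps ?(ltnW iln) // mulr_sumr; apply: eq_bigr => j _; lra.
have [nLD|LDn] := leqP n (L + D).
  rewrite [X in _ * X]big_geq // mulr0 big_nat; apply: sumr_ge0 => j jn.
  rewrite mulr_ge0 ?gap_ge0 ?sumr_ge0 //; first lia.
  by move=> i _; rewrite !mulr_ge0 ?ler0n.
rewrite [leRHS](@big_cat_nat _ _ _ (L + D)) ?(ltnW LDn) //=; last by lia.
rewrite -[leLHS]add0r lerD //.
  rewrite big_nat; apply: sumr_ge0 => j jn; rewrite mulr_ge0 ?gap_ge0 ?sumr_ge0 //; first lia.
  by move=> i _; rewrite !mulr_ge0 ?ler0n.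
rewrite mulr_sumr [leLHS]big_nat [leRHS]big_nat; apply: ler_sum => j jL.
have gj : 0 <= gap j by apply: gap_ge0; lia.
rewrite mulrCA ler_wpM2l //.
apply: (@le_trans _ _ ((coverage L (crossing n E) W D j)%:R * phi (j + D)%N)).
  by rewrite ler_wpM2r // ler_nat covW.
rewrite /coverage natr_sum mulr_suml.
pose f i := (W i)%:R * phi i * (crossing n E (minn i j) (maxn i j))%:R.
have f0 i : 0 <= f i by rewrite !mulr_ge0 ?ler0n.
apply: (@le_trans _ _ (\sum_(L <= i < j + D) f i)).
  rewrite big_nat [leRHS]big_nat; apply: ler_sum => i /andP[_ ijD].
  rewrite /f natrM -!mulrA ler_wpM2l ?ler0n // mulrC ler_wpM2r ?ler0n //.
  by apply: phi_le; exact: ltnW.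
have [jDn|njD] := leqP (j + D) n.
  rewrite [leRHS](@big_cat_nat _ _ _ (j + D)) //=; last by lia.
  by rewrite lerDl; apply: sumr_ge0 => i _; exact: f0.
rewrite (@big_cat_nat _ _ _ n) //= ?(ltnW njD) // [X in _ + X <= _]big_nat.
rewrite [X in _ + X <= _]big1 ?addr0 // => i /andP[ni _].
rewrite /f crossing_top ?mulr0 //; lia.
Qed.

(** Summed over all vertices, the eigenvalue inequality retains only the degree defects times [x],
    by symmetry of [E]. *)
Lemma defect_le k : (k < n)%N -> (\sum_(0 <= b < n) E k b < d)%N ->
  x k <= lam * tail 0.
Proof.
move=> kn dk; rewrite mulr_sumr.
apply: (@le_trans _ _ (\sum_(0 <= b < n) (d%:R * x b - \sum_(0 <= a < n) (E b a)%:R * x a))); last first.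
  rewrite [leLHS]big_nat [leRHS]big_nat; apply: ler_sum => b /andP[_]; exact: x_sub.
rewrite (_ : \sum_(0 <= b < n) _ =
    \sum_(0 <= b < n) (d - \sum_(0 <= a < n) E b a)%N%:R * x b); last first.
  rewrite big_split /= sumrN exchange_big_nat /= -sumrN -big_split /=.
  apply: eq_big_nat => b /andP[_ bn].
  rewrite natrB ?E_le // mulrBl -mulr_suml natr_sum; congr (_ - _ * _).
  by apply: eq_bigr => a _; rewrite E_sym.
have h i j : 0 <= \sum_(i <= b < j) (d - \sum_(0 <= a < n) E b a)%N%:R * x b.
  by apply: sumr_ge0 => b _; rewrite mulr_ge0.
rewrite (@big_cat_nat _ _ _ k) ?(ltnW kn) //= [X in _ <= _ + X]big_ltn //.
apply: (@le_trans _ _ ((d - \sum_(0 <= a < n) E k a)%N%:R * x k)).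
  by rewrite ler_peMl // ler1n; lia.
by rewrite addrCA lerDl addr_ge0.
Qed.

(** Think of [phi] as a cosine and of [s] as the matching sine. With [T] the sum of [x] against [s],
    the two sides of [flux_weights] become [c sg T] and [lam T / sg], up to errors at the lower end.
    These are multiples of [lam U], where [U] is the tail at [L], and the last hypothesis makes the
    sine at the start, [s0], large enough to absorb them. *)
Lemma flux_bound (c D : nat) W (phi s : nat -> R) (sg s0 : R) :
  dual_weights n L (crossing n E) c D W -> (0 < L <= n)%N ->
  (\sum_(0 <= b < n) E L.-1 b < d)%N -> 0 < x n.-1 -> 2 * lam * n%:R <= 1 ->
  (forall i, 0 <= phi i <= 1) -> (forall i, phi i.+1 <= phi i) -> 0 < sg ->
  (forall j, (L <= j < n)%N -> sg * s j <= phi (j + D)%N - phi (j.+1 + D)%N) ->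
  (forall j, (L <= j < n)%N -> sg * \sum_(L <= i < j.+1) phi i <= s j - s0) ->
  (forall j, (L <= j < n)%N -> 0 < s j <= 1) ->
  sg * (D%:R + c%:R * (1 + sg * D%:R) * (2 + D%:R)) <= s0 ->
  c%:R * sg ^+ 2 <= lam.
Proof.
move=> dW /andP[L0 Ln] dL xn lamn phi01 phid sg0 hphi hsum s01 hs0.
have phi0 i : 0 <= phi i by case/andP: (phi01 i).
have n0 : (0 < n)%N by clear -L0 Ln; lia.
have tail0 : 0 < tail 0.
  have -> : tail 0 = \sum_(0 <= b < n.-1.+1) x b by rewrite prednK.
  by rewrite big_nat_recr //= ltr_wpDl // sumr_ge0.
set t0 := x L.-1; set U := tail L.
have U0 : 0 <= U := tail_ge0 L.
have t00 : 0 <= t0 := x_ge0 _.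
have t0le : t0 <= lam * tail 0 by apply: defect_le => //; clear -L0 Ln; lia.
have lam0 : 0 <= lam by rewrite leNgt; apply/negP => lt0; nra.
have tailU : tail 0 <= n%:R * t0 + U.
  rewrite /tail (@big_cat_nat _ _ _ L) //= lerD2r.
  apply: (@le_trans _ _ (\sum_(0 <= b < L) t0)).
    rewrite [leLHS]big_nat [leRHS]big_nat; apply: ler_sum => b /andP[_ bL].
    by apply: x_homo; clear -L0 Ln bL; lia.
  rewrite sumr_const_nat subn0 mulr_natl -[leRHS]mulr_natl -[leLHS]mulr_natl.
  by rewrite ler_wpM2r // ler_nat.
(* From [t0 <= lam (n t0 + U)], where [lam n] is at most 1/2. *)
have t0U : t0 <= 2 * lam * U.
  have h1 := ler_wpM2l lam0 tailU; have h2 := ler_wpM2r t00 lamn; lra.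
have LnS : (L < n)%N.
  rewrite ltn_neqAle Ln andbT; apply/eqP => Leq.
  by move: t0U xn; rewrite /U /tail /t0 Leq big_geq // mulr0; lra.
(* Each gap is crossed by an edge, so it is at most the flux and hence at most [lam U]; this
   controls the [D] positions for which no coverage is known. *)
have stepU k : (L + k <= n)%N -> x (L + k).-1 <= t0 + k%:R * (lam * U).
  elim: k => [|k IH] Lk; first by rewrite addn0 mul0r addr0.
  have kn : (0 < L + k < n)%N by clear -L0 Lk; lia.
  have := gap_le_flux kn; have := @flux_le (L + k)%N; move=> /(_ ltac:(clear -Lk; lia)) h1 h2.
  have h3 : tail (L + k) <= U.
    by rewrite /U /tail [leRHS](@big_cat_nat _ _ _ (L + k)) ?leq_addr //= ?lerDr ?sumr_ge0 //; clear -Lk; lia.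
  have h4 := ler_wpM2l lam0 h3; have := IH ltac:(clear -Lk; lia).
  rewrite addnS /= -natr1; move: h1 h2; rewrite /gap; lra.
set q := minn (L + D) n; set M := x q.-1.
have M0 : 0 <= M := x_ge0 _.
have Lq : (L <= q <= n)%N by rewrite /q; clear -Ln; lia.
have MU : M <= (2 + D%:R) * (lam * U).
  have := stepU (q - L)%N; rewrite subnKC; last by case/andP: Lq.
  move=> /(_ ltac:(clear -Lq; lia)); rewrite -/M => h.
  have qD : (q - L)%:R <= D%:R :> R by rewrite ler_nat /q; clear; lia.
  have := ler_wpM2r (mulr_ge0 lam0 U0) qD; lra.
set T := \sum_(L <= k < n) x k * s k.
have T0 : 0 < T.
  have -> : T = \sum_(L <= k < n.-1.+1) x k * s k by rewrite prednK.
  rewrite big_nat_recr /=; last by clear -LnS; lia.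
  rewrite ltr_wpDl //.
    rewrite big_nat; apply: sumr_ge0 => i im; rewrite mulr_ge0 //.
    by have := s01 i ltac:(clear -im LnS Lq; lia); lra.
  by rewrite mulr_gt0 //; have := s01 n.-1 ltac:(clear -LnS; lia); lra.
have := flux_weights dW lam0 _ phi0 phid; rewrite L0 Ln => /(_ isT).
rewrite -/U /tail sum_tails //.
set A := \sum_(L <= k < n) _; set B := \sum_(L + D <= j < n) _ => main.
have hA : sg * A <= T - s0 * U.
  rewrite /A /T /U /tail !mulr_sumr -sumrN -big_split /=.
  rewrite [leLHS]big_nat [leRHS]big_nat; apply: ler_sum => k kn.
  have := ler_wpM2l (x_ge0 k) (hsum k kn); lra.
have hB : sg * (T - D%:R * M) - M <= B.
  have -> : B = \sum_(q <= j < n) gap j * phi (j + D)%N.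
    by rewrite /B /q; case: leqP => // nLD; rewrite !big_geq // ltnW.
  rewrite (@sum_by_parts _ x (fun j => phi (j + D)%N)) ?(leq_trans L0) //; [|by case/andP: Lq|by case/andP: Lq].
  apply: lerB; last by rewrite -/M -[leRHS]mulr1 ler_wpM2l //; case/andP: (phi01 (q + D)%N).
  apply: (@le_trans _ _ (\sum_(q <= j < n) x j * (phi (j + D)%N - phi (j.+1 + D)%N))); last first.
    by rewrite lerDl mulr_ge0.
  rewrite /T (@big_cat_nat _ _ _ q) //=; [|by case/andP: Lq|by case/andP: Lq].
  apply: (@le_trans _ _ (sg * \sum_(q <= i < n) x i * s i)).
    rewrite ler_wpM2l ?(ltW sg0) // lerBlDl lerD2r.
    apply: (@le_trans _ _ (\sum_(L <= i < q) M)).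
      rewrite [leLHS]big_nat [leRHS]big_nat; apply: ler_sum => i iq.
      rewrite -[M]mulr1 ler_pM //; first by have := s01 i ltac:(clear -iq Lq; lia); lra.
        by rewrite /M x_homo //; clear -iq Lq; lia.
      by have := s01 i ltac:(clear -iq Lq; lia); lra.
    rewrite sumr_const_nat -[leLHS]mulr_natl ler_wpM2r // ler_nat /q; clear; lia.
  rewrite mulr_sumr [leLHS]big_nat [leRHS]big_nat; apply: ler_sum => i iq.
  rewrite mulrCA ler_wpM2l // hphi //; clear -iq Lq; lia.
have c0 : 0 <= c%:R :> R by [].
have phiL : phi L * U <= U by rewrite ler_piMl //; case/andP: (phi01 L).
have m1 : sg * (c%:R * (sg * (T - D%:R * M) - M)) <= sg * (lam * (A + D%:R * (phi L * U))).
  rewrite ler_wpM2l ?(ltW sg0) //; apply: le_trans main; exact: ler_wpM2l.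
have m2 : lam * (sg * A) <= lam * (T - s0 * U) by rewrite ler_wpM2l.
have m3 : (lam * sg * D%:R) * (phi L * U) <= (lam * sg * D%:R) * U.
  by rewrite ler_wpM2l // !mulr_ge0 // ltW.
have m4 : (c%:R * sg * (1 + sg * D%:R)) * M <= (c%:R * sg * (1 + sg * D%:R)) * ((2 + D%:R) * (lam * U)).
  by rewrite ler_wpM2l // !mulr_ge0 ?addr_ge0 ?mulr_ge0 // ltW.
have m5 := ler_wpM2l (mulr_ge0 lam0 U0) hs0.
rewrite -(ler_pM2r T0); lra.
Qed.
End Flux.

(** * The discrete cosine test function *)

Section Trigonometry.
Variable R : realType.
Implicit Types x y h t : R.

Lemma sin_mvt x : 0 <= x -> exists2 y, 0 <= y <= x & sin x = x * cos y.
Proof.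
move=> x0; have cs : {within `[0, x], continuous (@sin R)}.
  by apply: continuous_subspaceT => z; exact: continuous_sin.
have ds z : z \in `]0, x[ -> is_derive z 1 (@sin R) (cos z).
  by move=> _; exact: is_derive_sin.
have [y] := MVT_segment x0 ds cs.
rewrite in_itv /= sin0 !subr0 => yx ->; exists y => //; exact: mulrC.
Qed.

Lemma sin_le x : 0 <= x -> sin x <= x.
Proof.
by move=> x0; have [y _ ->] := sin_mvt x0; rewrite ler_piMr // cos_le1.
Qed.

Lemma cos_ge x : 0 <= x -> 1 - x ^+ 2 / 2 <= cos x.
Proof.
move=> x0; have x20 : 0 <= x / 2 by lra.
have -> : cos x = 1 - 2 * sin (x / 2) ^+ 2.
  by rewrite {1}(_ : x = (x / 2) *+ 2) ?cos_mulr2n ?cos2sin2; [lra | lra].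
have := sin_le x20; have : - (x / 2) <= sin (x / 2).
  by have [y _ ->] := sin_mvt x20; rewrite -mulrN1 ler_wpM2l // cos_geN1.
move=> h1 h2; have h3 : 0 <= (x / 2 - sin (x / 2)) * (x / 2 + sin (x / 2)).
  by apply: mulr_ge0; lra.
lra.
Qed.

Lemma sin_ge x : 0 <= x -> x * (1 - x ^+ 2 / 2) <= sin x.
Proof.
move=> x0; have [y /andP[y0 yx] ->] := sin_mvt x0.
rewrite ler_wpM2l // (le_trans _ (cos_ge y0)) //.
by rewrite lerB // ler_wpM2r ?invr_ge0 // ler_pXn2r // nnegrE.
Qed.

Lemma cos_sub_cos t h : cos (t - h) - cos (t + h) = 2 * sin h * sin t.
Proof. rewrite cosB cosD; lra. Qed.

Lemma sin_sub_sin t h : sin (t + h) - sin (t - h) = 2 * sin h * cos t.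
Proof. rewrite sinB sinD; lra. Qed.

Lemma sum_cos t (a : R) (L j : nat) : (L <= j)%N ->
  2 * sin (t / 2) * \sum_(L <= i < j) cos (t * (i%:R + a)) =
  sin (t * (j%:R + a - 2^-1)) - sin (t * (L%:R + a - 2^-1)).
Proof.
move/subnKC <-; elim: (j - L)%N => [|k IH].
  by rewrite addn0 big_geq // mulr0 subrr.
rewrite addnS big_nat_recr ?leq_addr //= mulrDr IH -sin_sub_sin.
rewrite (_ : t * ((L + k)%:R + a) + t / 2 = t * ((L + k).+1%:R + a - 2^-1)).
  rewrite (_ : t * ((L + k)%:R + a) - t / 2 = t * ((L + k)%:R + a - 2^-1)); lra.
by rewrite -[(L + k).+1%:R]natr1; lra.
Qed.

Lemma le_sin x y : - (pi / 2) <= x -> x <= y -> y <= pi / 2 -> sin x <= sin y.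
Proof.
move=> x0 xy y1; rewrite leNgt ltr_sin ?in_itv /= -?leNgt //; apply/andP; split; lra.
Qed.

Lemma le_cos x y : 0 <= x -> x <= y -> y <= pi -> cos y <= cos x.
Proof.
move=> x0 xy y1; rewrite leNgt ltr_cos ?in_itv /= -?leNgt //; apply/andP; split; lra.
Qed.

Lemma pi_lt4 : pi < 4 :> R.
Proof. by have := @pihalf_lt2 R; lra. Qed.

(** With arguments shifted by one half, differences of the cosine and sums of it are sines times
    exactly [sg] or its inverse. The further shift [al] moves the start away from the zero of the
    sine, so that [s0] covers the boundary errors; the room for it is the reason for [n + C]. *)
Lemma cosine_test (c D : nat) : exists C : nat, forall n L : nat, (0 < L <= n)%N ->
  let sg := 2 * sin (pi / (4 * (n + C)%:R)) : R in
  0 < sg /\ exists phi s s0,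
  [/\ (forall i, 0 <= phi i <= 1) /\ (forall i, phi i.+1 <= phi i),
      forall j, (L <= j < n)%N -> sg * s j <= phi (j + D)%N - phi (j.+1 + D)%N,
      forall j, (L <= j < n)%N -> sg * \sum_(L <= i < j.+1) phi i <= s j - s0,
      forall j, (L <= j < n)%N -> 0 < s j <= 1 &
      sg * (D%:R + c%:R * (1 + sg * D%:R) * (2 + D%:R)) <= s0].
Proof.
(* The left side of the last inequality is at most [t * al / 2], and [sin u >= u / 2] for
   [u = t * al <= 1]. *)
pose al := (2 * (D + c * (1 + D) * (2 + D)))%N.
exists (2 * al + D + 2)%N => n L /andP[L0 Ln].
set N := (n + _)%N; pose t : R := pi / 2 / N%:R.
have N0 : 0 < N%:R :> R by rewrite ltr0n /N; lia.
have pi0 := @pi_gt0 R.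
have t0 : 0 < t by rewrite !divr_gt0.
have tN : t * N%:R = pi / 2 by rewrite /t divfK // gt_eqF.
have tle (y : R) : y <= N%:R -> t * y <= pi / 2 by rewrite -tN ler_pM2l.
have -> /= : pi / (4 * N%:R) = t / 2 :> R by rewrite /t invfM; lra.
set sg := 2 * sin (t / 2).
have t2 : t <= pi / 2 by rewrite -[t]mulr1 tle // ler1n /N; lia.
have sg0 : 0 < sg by rewrite mulr_gt0 // sin_gt0_pi //; lra.
have sgt : sg <= t by have := @sin_le (t / 2); rewrite /sg => /(_ ltac:(lra)); lra.
split=> //.
(* Freezing the argument from [n + D] on keeps it in the first quarter period, so [phi] is
   nonnegative and nonincreasing for all [i]. *)
pose phi i := cos (t * ((minn i (n + D))%:R + al%:R)).
pose s j := sin (t * (j.+1%:R + al%:R - 2^-1)).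
have argle i : (minn i (n + D))%:R + al%:R <= N%:R :> R.
  by rewrite -natrD ler_nat /N; lia.
have arg0 i : 0 <= (minn i (n + D))%:R + al%:R :> R by rewrite addr_ge0.
exists phi, s, (sin (t * (L%:R + al%:R - 2^-1))); split.
- split=> i.
    rewrite cos_le1 andbT cos_ge0_pihalf // tle // andbT.
    by rewrite (@le_trans _ _ 0) ?mulr_ge0 ?(ltW t0) //; lra.
  apply: le_cos; first by rewrite mulr_ge0 // ltW.
    by rewrite ler_pM2l // lerD2r ler_nat; lia.
  by rewrite (le_trans (tle _ (argle _))) //; lra.
- move=> j /andP[Lj jn]; rewrite /phi (minn_idPl _) ?(minn_idPl _); [|lia|lia].
  rewrite (_ : t * ((j + D)%:R + al%:R) = t * ((j + D).+1%:R + al%:R - 2^-1) - t / 2); last first.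
    by rewrite -[(j + D).+1%:R]natr1; lra.
  rewrite (_ : t * ((j.+1 + D)%:R + al%:R) = t * ((j + D).+1%:R + al%:R - 2^-1) + t / 2); last first.
    by rewrite addSn; lra.
  rewrite cos_sub_cos ler_pM2l // /s; apply: le_sin.
  + rewrite (@le_trans _ _ 0) //; first lra.
    rewrite mulr_ge0 ?(ltW t0) // -natr1 -addrA; have : 0 <= j%:R :> R by []; have : 0 <= al%:R :> R by [].
    lra.
  + by rewrite ler_pM2l // lerD2r lerD2r ler_nat; lia.
  + apply: tle; have : (j + D).+1%:R + al%:R <= N%:R :> R by rewrite -natrD ler_nat /N; lia.
    lra.
- move=> j /andP[Lj jn].
  rewrite -(@sum_cos t al%:R L j.+1) ?leqW // ler_pM2l //.
  rewrite le_eqVlt; apply/orP; left; apply/eqP; apply: eq_big_nat => i ij.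
  by rewrite /phi (minn_idPl _) //; lia.
- move=> j /andP[Lj jn]; rewrite /s sin_le1 andbT sin_gt0_pi //.
  have h : j.+1%:R + al%:R <= N%:R :> R by rewrite -natrD ler_nat /N; lia.
  have h1 : 1 <= j.+1%:R :> R by rewrite ler1n.
  have h2 : 0 <= al%:R :> R by [].
  have := tle (j.+1%:R + al%:R - 2^-1) ltac:(lra).
  have : 0 < t * (j.+1%:R + al%:R - 2^-1) by rewrite mulr_gt0 //; lra.
  lra.
- have tal : t * al%:R <= 1.
    have : 2 * al%:R <= N%:R :> R by rewrite -natrM ler_nat /N; lia.
    move=> h; have : t * (2 * al%:R) <= t * N%:R by rewrite ler_pM2l.
    by have := @pihalf_lt2 R; rewrite tN; lra.
  have tal0 : 0 <= t * al%:R by rewrite mulr_ge0 // ltW.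
  have L1 : 1 <= L%:R :> R by rewrite ler1n.
  apply: (@le_trans _ _ (sin (t * al%:R))); last first.
    apply: le_sin; first by lra.
      by rewrite ler_pM2l //; lra.
    apply: tle; have : L%:R + al%:R <= N%:R :> R by rewrite -natrD ler_nat /N; lia.
    lra.
  apply: le_trans (sin_ge tal0).
  have sg1 : sg * D%:R <= D%:R.
    rewrite ler_piMl // (le_trans sgt) //.
    have : t * 2 <= t * N%:R by rewrite ler_pM2l // ler_nat /N; lia.
    by have := @pihalf_lt2 R; rewrite tN; lra.
  apply: (@le_trans _ _ (t * (al%:R / 2))).
    rewrite ler_pM ?(ltW sg0) //.
      have sg0' := ltW sg0; apply: addr_ge0 => //; apply: mulr_ge0 => //.
        by apply: mulr_ge0 => //; apply: addr_ge0 => //; apply: mulr_ge0.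
    have -> : al%:R / 2 = (D + c * (1 + D) * (2 + D))%N%:R :> R by rewrite /al natrM; lra.
    rewrite natrD !natrM !natrD lerD2l.
    by rewrite ler_wpM2r ?addr_ge0 // ler_wpM2l // lerD2l.
  move: tal tal0; rewrite mulrA; set u := t * al%:R => u1 u0.
  have : 0 <= u * ((1 - u) * (1 + u)) by apply: mulr_ge0 => //; apply: mulr_ge0; lra.
  lra.
Qed.

End Trigonometry.

(** * Eigenvalues of nonregular graphs *)

Lemma degreeE n (e : rel 'I_n) v : degree e v = (\sum_(w < n) e v w)%N.
Proof.
by rewrite /degree -sum1_card big_mkcond; apply: eq_bigr => w _; rewrite inE; case: (e v w).
Qed.

Section Sorting.
Variables (R : realType) (n d : nat) (e : rel 'I_n) (y : 'I_n -> R) (i0 : 'I_n).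
Hypotheses (e_graph : simple_graph e) (e_conn : connected_graph e).

Definition sorted_vertices : seq 'I_n := sort (fun i j => y i <= y j) (enum 'I_n).
Let s := sorted_vertices.

Definition sorted_edge a b := [&& (a < n)%N, (b < n)%N & e (nth i0 s a) (nth i0 s b)].

Lemma size_sorted_vertices : size s = n.
Proof. by rewrite size_sort size_enum_ord. Qed.

Lemma mem_sorted_vertices v : v \in s.
Proof. by rewrite mem_sort mem_enum. Qed.

Lemma uniq_sorted_vertices : uniq s.
Proof. by rewrite sort_uniq enum_uniq. Qed.

Lemma index_lt v : (index v s < n)%N.
Proof. by rewrite -[X in (_ < X)%N]size_sorted_vertices index_mem mem_sorted_vertices. Qed.

Lemma sum_sorted_vertices (T : nmodType) (F : 'I_n -> T) :
  \sum_(0 <= b < n) F (nth i0 s b) = \sum_(v < n) F v.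
Proof.
rewrite -[X in \sum_(0 <= b < X) _]size_sorted_vertices -(big_nth i0 xpredT).
by rewrite (perm_big (enum 'I_n)) ?big_enum //= perm_sort.
Qed.

Lemma sorted_homo a b : (a <= b < n)%N -> y (nth i0 s a) <= y (nth i0 s b).
Proof.
move=> /andP[ab bn].
have tr : transitive (fun i j : 'I_n => y i <= y j) by move=> ? ? ?; exact: le_trans.
have so : sorted (fun i j => y i <= y j) s.
  by apply: sort_sorted => i j; exact: le_total.
have re : reflexive (fun i j : 'I_n => y i <= y j) by move=> ?; exact: lexx.
apply: (sorted_leq_nth tr re i0 so) => //.
  by rewrite inE size_sorted_vertices (leq_ltn_trans ab).
by rewrite inE size_sorted_vertices.
Qed.

Lemma sorted_edge_sym : symmetric sorted_edge.
Proof. by move=> a b; rewrite /sorted_edge andbCA e_graph.1. Qed.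

Lemma sorted_edge_irr : irreflexive sorted_edge.
Proof. by move=> a; rewrite /sorted_edge e_graph.2 !andbF. Qed.

Lemma sorted_degree a : (a < n)%N ->
  (\sum_(0 <= b < n) sorted_edge a b)%N = degree e (nth i0 s a).
Proof.
move=> an; rewrite degreeE -(sum_sorted_vertices (fun w => e (nth i0 s a) w : nat)).
by apply: eq_big_nat => b /andP[_ bn]; rewrite /sorted_edge an bn.
Qed.

Lemma sorted_edge_cut i : (0 < i < n)%N ->
  exists a b, (a < i <= b)%N /\ (b < n)%N /\ sorted_edge a b.
Proof.
move=> /andP[ip iln].
case: (pselect (exists u w, [/\ (index u s < i)%N, (i <= index w s)%N & e u w])).
  move=> [u [w [ui iw uw]]]; exists (index u s), (index w s).
  rewrite ui iw index_lt /sorted_edge !index_lt !nth_index ?mem_sorted_vertices //.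
move=> none; pose A := [pred u | (index u s < i)%N].
have clA : fingraph.closed e A.
  move=> u w uw; rewrite !inE; apply/idP/idP => h; rewrite ltnNge; apply/negP => h'.
    by apply: none; exists u, w.
  by apply: none; exists w, u; rewrite e_graph.1.
have := fingraph.closed_connect clA (e_conn (nth i0 s 0) (nth i0 s i)).
by rewrite !inE !index_uniq ?uniq_sorted_vertices ?size_sorted_vertices ?ip ?ltnn // (ltn_trans ip).
Qed.

End Sorting.

Section EigenvalueGap.
Variables (R : realType) (d : nat).
Hypothesis d3 : (3 <= d)%N.

Lemma eigenvalue_abs n (e : rel 'I_n) (a : R) : simple_graph e ->
  eigenvalue (adjacency_matrix R e) a ->
  exists y : 'I_n -> R, [/\ forall i, 0 <= y i, exists i, 0 < y i &
    forall i, a * y i <= \sum_(j < n) (e i j)%:R * y j].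
Proof.
move=> [esym _] /eigenvalueP[v vA v0]; exists (fun i => `|v 0 i|); split=> //.
  have [j vj] : exists j, v 0 j != 0 by apply/rV0Pn.
  by exists j; rewrite normr_gt0.
move=> i; have := congr1 (fun w : 'rV_n => w 0 i) vA; rewrite !mxE => h.
rewrite (le_trans (ler_norm _)) // normrM normr_id -normrM -h.
rewrite (le_trans (ler_norm_sum _ _ _)) // ler_sum // => j _.
by rewrite !mxE normrM normr_nat mulrC esym.
Qed.

(** An eigenvalue that violates the smallness condition is so far from [d] that the bound is trivial
    for large [n]; [gap_bound_small] settles that case. *)
Lemma eigenvalue_gap : exists C : nat, forall n (e : rel 'I_n) (a : R),
  nonregular_family d e -> eigenvalue (adjacency_matrix R e) a ->
  2 * (d%:R - a) * n%:R <= 1 ->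
  (if odd d then d - 1 else 2 * d - 4)%N%:R * (2 * sin (pi / (4 * (n + C)%:R))) ^+ 2
    <= d%:R - a.
Proof.
have [C hC] := @cosine_test R (if odd d then d - 1 else 2 * d - 4)%N (2 * d + 1).
exists C => n e a [e_graph e_conn e_nreg e_max] /(eigenvalue_abs e_graph).
move=> [y [y0 [i0 yi0] ya]] small.
have degle v : (degree e v <= d)%N.
  by rewrite -e_max /max_degree (leq_bigmax_cond v).
set s := sorted_vertices y; set E := sorted_edge e y i0.
pose P k := (k < n)%N && (degree e (nth i0 s k) < d)%N.
have n0 : (0 < n)%N by apply: leq_trans (ltn_ord i0).
have exP : exists k, P k.
  apply: contrapT => none; apply: e_nreg; exists d => v.
  apply/eqP; rewrite eqn_leq degle leqNgt /=; apply/negP => dv.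
  by apply: none; exists (index v s); rewrite /P index_lt nth_index ?mem_sorted_vertices.
have [m /andP[mn dm] mmax] := ex_maxnP exP (m := n) (fun k Pk => ltnW (andP Pk).1).
have E_sym : symmetric E by apply: sorted_edge_sym.
have E_irr : irreflexive E by apply: sorted_edge_irr.
have E_cut := sorted_edge_cut y i0 e_graph e_conn.
have E_deg k : (m.+1 <= k < n)%N -> (\sum_(0 <= b < n) E k b)%N = d.
  move=> /andP[mk kn]; rewrite sorted_degree //; apply/eqP.
  rewrite eqn_leq degle leqNgt /=; apply/negP => dk.
  by have := mmax k; rewrite /P kn dk => /(_ isT); rewrite leqNgt mk.
have prof := crossing_profile E_sym E_irr E_cut E_deg.
have [W dW] := dual_weights_exist d3 (ltn0Sn m) prof.
have [sg0 [phi [t [t0 [[p1 p2] p3 p4 p5 p6]]]]] := hC n m.+1 mn.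
apply: (@flux_bound R n m.+1 d E (fun k => y (nth i0 s k)) (d%:R - a) E_sym E_cut _ _ _ _
   _ _ W phi t _ t0 dW) => //.
- by move=> k kn; rewrite sorted_degree.
- by move=> i j; exact: sorted_homo.
- move=> b bn.
  rewrite mulrBl lerD2l lerN2 (le_trans (ya _)) //.
  rewrite -(sum_sorted_vertices y i0 (fun w => (e (nth i0 s b) w)%:R * y w)).
  rewrite le_eqVlt; apply/orP; left; apply/eqP; apply: eq_big_nat => k /andP[_ kn].
  by rewrite /E /sorted_edge bn kn.
- by rewrite sorted_degree.
- have i0n : (index i0 s <= n.-1 < n)%N.
    by rewrite -ltnS prednK // index_lt leqnn.
  have := sorted_homo y i0 i0n; rewrite nth_index ?mem_sorted_vertices //.
  exact: lt_le_trans.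
Qed.

End EigenvalueGap.

(** * Rayleigh quotients *)

Section Rayleigh.
Variables (R : realType) (n : nat) (A : 'M[R]_n).
Hypothesis A_sym : A^T = A.
Implicit Types u v w : 'rV[R]_n.

Let dot u v : R := \sum_(i < n) u 0 i * v 0 i.

Lemma dotC u v : dot u v = dot v u.
Proof. by apply: eq_bigr => i _; rewrite mulrC. Qed.

Lemma dotDl u v w : dot (u + v) w = dot u w + dot v w.
Proof. by rewrite /dot -big_split; apply: eq_bigr => i _; rewrite mxE mulrDl. Qed.

Lemma dotZl a u v : dot (a *: u) v = a * dot u v.
Proof. by rewrite /dot mulr_sumr; apply: eq_bigr => i _; rewrite mxE mulrA. Qed.

Lemma dotDr u v w : dot u (v + w) = dot u v + dot u w.
Proof. by rewrite dotC dotDl !(dotC u). Qed.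

Lemma dotZr a u v : dot u (a *: v) = a * dot u v.
Proof. by rewrite dotC dotZl dotC. Qed.

Lemma dot_ge0 u : 0 <= dot u u.
Proof. by apply: sumr_ge0 => i _; rewrite -expr2 sqr_ge0. Qed.

Lemma dot_eq0 u : dot u u = 0 -> u = 0.
Proof.
move=> /eqP; rewrite psumr_eq0 => [/allP h|i _]; last by rewrite -expr2 sqr_ge0.
apply/rowP => i; rewrite mxE; apply/eqP.
by have := h i (mem_index_enum i); rewrite /= mulf_eq0 orbb.
Qed.

Lemma dot_mulmx u v : dot (u *m A) v = dot u (v *m A).
Proof.
rewrite /dot; under eq_bigr do rewrite mxE mulr_suml.
rewrite exchange_big /=; apply: eq_bigr => i _; rewrite mxE mulr_sumr.
by apply: eq_bigr => j _; rewrite -{1}A_sym mxE mulrAC mulrA.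
Qed.

Lemma continuous_entry i : continuous (fun v : 'rV[R]_n => v 0 i).
Proof. exact: coord_continuous. Qed.

Lemma continuous_dot (f g : 'rV[R]_n -> 'rV[R]_n) :
  (forall i, continuous (fun v => f v 0 i)) ->
  (forall i, continuous (fun v => g v 0 i)) ->
  continuous (fun v => dot (f v) (g v)).
Proof.
move=> cf cg; apply: continuous_big => [|i _]; first exact: add_continuous.
by move=> v; exact: (cvgM (cf i v) (cg i v)).
Qed.

Lemma continuous_mulmx i : continuous (fun v : 'rV[R]_n => (v *m A) 0 i).
Proof.
rewrite (_ : (fun v => _) = (fun v : 'rV[R]_n => \sum_k v 0 k * A k i)); last first.
  by apply/funext => v; rewrite mxE.
apply: continuous_big => [|k _]; first exact: add_continuous.
by move=> v; exact: (cvgM (@continuous_entry k v) (cvg_cst (A k i))).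
Qed.

Lemma rayleigh_max : (0 < n)%N -> exists c, dot c c = 1 /\
  forall v, dot (v *m A) v <= dot (c *m A) c * dot v v.
Proof.
move=> n0; pose S := [set v : 'rV[R]_n | dot v v = 1].
have S0 : S !=set0.
  exists (delta_mx 0 (Ordinal n0)); rewrite /S /= /dot (bigD1 (Ordinal n0)) //=.
  rewrite mxE !eqxx mulr1 big1 ?addr0 // => i /negPf ni.
  by rewrite mxE ni andbF mul0r.
have Scl : closed S.
  have -> : S = (fun v => dot v v) @^-1` [set x | x = 1] by [].
  apply: closed_comp; last exact: closed_eq.
  by move=> v _; apply: continuous_dot => i; exact: continuous_entry.
have Sc : compact S.
  have cube : compact [set v : 'rV[R]_n | forall i, v ord0 i \in `[(-1), 1]].
    apply: (@rV_compact _ _ (fun=> `[(-1 : R), (1 : R)]%classic)).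
    by move=> _; exact: segment_compact.
  apply: (subclosed_compact Scl cube) => v /= vv i; rewrite in_itv /= -ler_norml.
  rewrite -[leRHS]sqrtr1 -sqrtr_sqr ler_sqrt // -vv /dot (bigD1 i) //= expr2 lerDl.
  by apply: sumr_ge0 => j _; rewrite -expr2 sqr_ge0.
have [|c cS cmax] := @EVT_max_rV R n (fun v => dot (v *m A) v) S S0 Sc.
  apply: continuous_subspaceT; apply: continuous_dot => i.
    exact: continuous_mulmx.
  exact: continuous_entry.
rewrite inE in cS; exists c; split=> // v.
have [->|v0] := eqVneq v 0.
  have d0 w : dot 0 w = 0 by rewrite /dot big1 // => i _; rewrite mxE mul0r.
  by rewrite mul0mx !d0 mulr0.
have dv : 0 < dot v v.
  by rewrite lt0r dot_ge0 andbT; apply: contra_neq v0; exact: dot_eq0.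
pose r := (Num.sqrt (dot v v))^-1.
have rr : r * r = (dot v v)^-1 by rewrite -invfM -expr2 sqr_sqrtr ?dot_ge0.
have := cmax (r *: v); rewrite inE /S /= dotZl dotZr mulrA rr mulVf ?gt_eqF // => /(_ erefl).
rewrite -scalemxAl dotZl dotZr mulrA rr.
by rewrite ler_pdivrMl // mulrC.
Qed.

(** A maximizer [c] on the unit sphere is an eigenvector: moving it by [t] along its residual [w]
    gives [2 t p <= t ^ 2 K] for all [t], with [p] the squared norm of [w], and [t = p / (K + 1)]
    then contradicts [p > 0]. *)
Lemma rayleigh_eigenvalue u (r : R) : u != 0 -> r * dot u u <= dot (u *m A) u ->
  exists2 a, r <= a & eigenvalue A a.
Proof.
move=> u0 ru; have n0 : (0 < n)%N.
  rewrite lt0n; apply: contra_neq u0 => n0.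
  by apply/rowP => i; have := ltn_ord i; rewrite {2}n0.
have [c [c1 cmax]] := rayleigh_max n0.
set M := dot (c *m A) c in cmax.
have du : 0 < dot u u.
  by rewrite lt0r dot_ge0 andbT; apply: contra_neq u0; exact: dot_eq0.
exists M; first by rewrite -(ler_pM2r du) (le_trans ru).
apply/eigenvalueP; exists c; last first.
  apply: contra_eq_neq c1 => ->; rewrite /dot big1 => [|i _].
    by rewrite eq_sym oner_neq0.
  by rewrite mxE mul0r.
have [w wdef] : exists w, w = c *m A - M *: c by eexists.
suff /dot_eq0 w0 : dot w w = 0 by apply/eqP; rewrite -subr_eq0 -wdef w0.
have wE v : dot w v = dot (c *m A) v - M * dot c v.
  by rewrite wdef dotDl -scaleNr dotZl mulNr.
set p := dot w w; pose K := M * dot w w - dot (w *m A) w.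
have key t : 2 * t * p <= t ^+ 2 * K.
  have := cmax (c + t *: w).
  have -> : dot (c + t *: w) (c + t *: w) = 1 + 2 * t * dot c w + t ^+ 2 * dot w w.
    by rewrite dotDl !dotDr !dotZl !dotZr c1 [dot w c]dotC; lra.
  have -> : dot ((c + t *: w) *m A) (c + t *: w) =
      M + 2 * t * dot (c *m A) w + t ^+ 2 * dot (w *m A) w.
    rewrite mulmxDl -scalemxAl dotDl !dotDr !dotZl !dotZr -/M.
    by rewrite [dot (w *m A) c]dot_mulmx [dot w (c *m A)]dotC; lra.
  by rewrite /p /K wE; lra.
have p0 : 0 <= p := dot_ge0 w.
apply/eqP; rewrite eq_le p0 andbT leNgt; apply/negP => pp.
have K0 : 0 <= K by have := key (-1); have := key 1; lra.
have K1 : 0 < K + 1 by lra.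
pose t := p / (K + 1); have t0 : 0 < t by apply: divr_gt0.
have tK : t * (K + 1) = p by rewrite divfK // gt_eqF.
have h1 : t * (t * (K + 1)) = t * p by rewrite tK.
by have := key t; have := mulr_gt0 t0 pp; have := mulr_gt0 t0 t0; lra.
Qed.

End Rayleigh.

(** * Chains of blocks *)

Section Chain.
Variables (R : realType) (d p r k T : nat) (cap : rel nat).
Hypotheses (d3 : (3 <= d)%N) (p0 : (0 < p)%N) (pd : (p < d)%N).
Hypotheses (r0 : (0 < r)%N) (k0 : (0 < k)%N) (Td : (d < T)%N).
Hypotheses (cap_sym : symmetric cap) (cap_irr : irreflexive cap).
Hypothesis cap_deg : forall t, (t < T)%N ->
  (\sum_(0 <= t' < T) cap t t' + (t < p))%N = d.
Hypothesis cap_conn : forall t, (t < T)%N ->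
  [\/ t = 0%N, cap 0 t | exists2 t', (t' < T)%N & cap 0 t' && cap t' t].

(* A path on r vertices, then k blocks, then a cap on T vertices.  A block is the complete
   graph on the offsets 0, ..., d without the edges from 0 to the p top offsets; these top
   offsets are joined to the offset 0 of the next block or, in the last block, to the
   first p vertices of the cap. *)
Let top o := (d - p < o)%N.
Let inner o o' := [&& o != o', ~~ ((o == 0%N) && top o') & ~~ ((o' == 0%N) && top o)].
Let blocks b o b' o' := [|| (b' == b) && inner o o', (b' == b.+1) && (top o && (o' == 0%N))
  | (b == b'.+1) && (top o' && (o == 0%N))].
Let port b o t := [&& b.+1 == k, o == (d - p).+1 + t & t < p]%N.
Let entry i b o := [&& i.+1 == r, b == 0 & o == 0]%N.
Let step i j := (j == i.+1) || (i == j.+1).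

Definition chain_vertex : finType := ('I_r + ('I_k * 'I_d.+1 + 'I_T))%type.

Definition chain_edge (u v : chain_vertex) : bool :=
  match u, v with
  | inl i, inl j => step i j
  | inl i, inr (inl (b, o)) => entry i b o
  | inl _, inr (inr _) => false
  | inr (inl (b, o)), inl i => entry i b o
  | inr (inl (b, o)), inr (inl (b', o')) => blocks b o b' o'
  | inr (inl (b, o)), inr (inr t) => port b o t
  | inr (inr _), inl _ => false
  | inr (inr t), inr (inl (b, o)) => port b o t
  | inr (inr t), inr (inr t') => cap t t'
  end.

Lemma inner_sym o o' : inner o o' = inner o' o.
Proof. by rewrite /inner eq_sym [X in _ && X]andbC. Qed.

Lemma chain_edge_sym : symmetric chain_edge.
Proof.
move=> [i|[[b o]|t]] [j|[[b' o']|t']] //=; rewrite ?cap_sym //.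
  by rewrite /step orbC.
by rewrite /blocks eq_sym inner_sym; congr (_ || _); rewrite orbC.
Qed.

Lemma chain_edge_irr : irreflexive chain_edge.
Proof.
move=> [i|[[b o]|t]] //=.
  by rewrite /step; lia.
by rewrite /blocks /inner eqxx /=; lia.
Qed.

Lemma chain_connect u : connect chain_edge (inl (Ordinal r0)) u.
Proof.
have cpath i : connect chain_edge (inl (Ordinal r0)) (inl i).
  case: i => i; elim: i => [|i IH] ir.
    by rewrite (_ : Ordinal ir = Ordinal r0) ?connect0 //; exact: val_inj.
  apply: connect_trans (IH (ltnW ir)) _; apply: connect1.
  by rewrite /= /step /= eqxx.
have cin b : connect chain_edge (inl (Ordinal r0)) (inr (inl (b, ord0))) ->
    forall o, connect chain_edge (inl (Ordinal r0)) (inr (inl (b, o))).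
  move=> cb0; have d1 : (1 < d.+1)%N by lia.
  have cb1 : connect chain_edge (inl (Ordinal r0)) (inr (inl (b, Ordinal d1))).
    apply: connect_trans cb0 _; apply: connect1.
    by rewrite /= /blocks /inner /top eqxx /=; lia.
  move=> o; have [->|o0] := eqVneq o ord0; first by [].
  have {}o0 : (0 < o)%N by rewrite lt0n; apply: contraNneq o0 => h; apply/eqP/val_inj.
  have [to|nto] := boolP (top o); last first.
    apply: connect_trans cb0 _; apply: connect1.
    by move: nto; rewrite /= /blocks /inner /top eqxx /=; lia.
  apply: connect_trans cb1 _; apply: connect1.
  by move: to; rewrite /= /blocks /inner /top eqxx /=; lia.
have cblock b o : connect chain_edge (inl (Ordinal r0)) (inr (inl (b, o))).
  case: b => b bk; apply: (cin); elim: b bk => [|b IH] bk.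
    have rr : (r.-1 < r)%N by lia.
    apply: connect_trans (cpath (Ordinal rr)) _; apply: connect1.
    by rewrite /= /entry /= prednK // eqxx.
  apply: connect_trans (cin _ (IH (ltnW bk)) ord_max) _; apply: connect1.
  by rewrite /= /blocks /top /=; lia.
case: u => [i|[[b o]|t]] //.
have T0 : (0 < T)%N by lia.
have ct0 : connect chain_edge (inl (Ordinal r0)) (inr (inr (Ordinal T0))).
  have kk : (k.-1 < k)%N by lia.
  have pp : ((d - p).+1 < d.+1)%N by lia.
  apply: connect_trans (cblock (Ordinal kk) (Ordinal pp)) _; apply: connect1.
  by rewrite /= /port /= prednK // addn0 !eqxx.
case: t => t tT; case: (cap_conn tT) => [t0|ct|[t' t'T /andP[c1 c2]]].
- by rewrite (_ : Ordinal tT = Ordinal T0) //; apply: val_inj.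
- by apply: connect_trans ct0 _; apply: connect1.
- apply: connect_trans ct0 _; apply: connect_trans (connect1 _) (connect1 _).
    by instantiate (1 := inr (inr (Ordinal t'T))).
  by [].
Qed.

Lemma sum_chain (M : nmodType) (F : chain_vertex -> M) :
  \sum_u F u = \sum_(i < r) F (inl i) +
    (\sum_(b < k) \sum_(o < d.+1) F (inr (inl (b, o))) + \sum_(t < T) F (inr (inr t))).
Proof.
rewrite big_sumType /= big_sumType /=; congr (_ + (_ + _)).
by rewrite pair_big; apply: eq_bigr => -[].
Qed.

Lemma sum_pick (M : nmodType) (n m : nat) (F : nat -> M) :
  \sum_(i < n) (if i == m :> nat then F i else 0) = if (m < n)%N then F m else 0.
Proof.
rewrite -big_mkcond /=; case: ltnP => mn.
  by rewrite (big_pred1 (Ordinal mn)).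
by rewrite big_pred0 // => i; apply/negbTE; rewrite neq_ltn (leq_trans (ltn_ord i)).
Qed.

(** Functions that are constant on each of the three classes of offsets in a block; taking neighbour
    sums inside the block preserves this form. *)
Definition by_level (a b c : R) o : R := if o == 0%N then a else if top o then c else b.

Lemma sum_by_level a b c :
  \sum_(o < d.+1) by_level a b c o = a + (d - p)%:R * b + p%:R * c.
Proof.
rewrite big_ord_recl /= {1}/by_level eqxx -addrA; congr (_ + _).
rewrite -(big_mkord xpredT (fun o => by_level a b c o.+1)) /=.
rewrite (@big_cat_nat _ _ _ (d - p)) ?leq_subr //=; congr (_ + _).
  rewrite (@eq_big_nat _ _ _ _ _ _ (fun=> b)) ?sumr_const_nat ?subn0 ?mulr_natl //.
  by move=> i id; rewrite /by_level /top ifF //; lia.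
rewrite (@eq_big_nat _ _ _ _ _ _ (fun=> c)).
  by rewrite sumr_const_nat mulr_natl; congr (_ *+ _); lia.
by move=> i id; rewrite /by_level /top ifT //; lia.
Qed.

Lemma sum_inner o a b c : (o <= d)%N ->
  \sum_(o' < d.+1) (inner o o')%:R * by_level a b c o' =
  by_level ((d - p)%:R * b) (a + (d - p)%:R * b + p%:R * c - b)
    ((d - p)%:R * b + p%:R * c - c) o.
Proof.
move=> od; have pick (g : R) : \sum_(o' < d.+1) (if o' == o :> nat then g else 0) = g.
  by rewrite sum_pick ltnS od.
rewrite {2}/by_level; have [ o0|o0] := eqVneq o 0%N.
  rewrite (eq_bigr (fun o' : 'I_d.+1 => by_level 0 b 0 o')).
    by rewrite sum_by_level add0r mulr0 addr0.
  move=> o' _; rewrite /inner o0 /by_level /top eqxx /= [_ == 0%N]eq_sym.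
  by case: ifP => //= _; rewrite ?mul0r //; case: ifP => _ /=; rewrite ?mul0r ?mul1r ?andbF.
have [to|nto] := boolP (top o).
  rewrite -[X in _ - X](pick c) -[(d - p)%:R * b]add0r -sum_by_level -sumrB; apply: eq_bigr => o' _.
  rewrite /inner to (negPf o0) /= andbT [_ == o]eq_sym /by_level.
  have [<-|no] := eqVneq o (o' : nat).
    by rewrite (negPf o0) to mul0r subrr.
  by have [ o'0|o'0] := eqVneq (o' : nat) 0%N; rewrite /= ?mul0r ?mul1r subr0.
rewrite -[X in _ - X](pick b) -sum_by_level -sumrB; apply: eq_bigr => o' _.
rewrite /inner (negPf nto) (negPf o0) /= !andbF /= andbT [_ == o]eq_sym /by_level.
have [<-|no] := eqVneq o (o' : nat); last by rewrite mul1r subr0.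
by rewrite (negPf o0) (negPf nto) mul0r subrr.
Qed.

Section EdgeSums.
Variables (al be ga : nat -> R) (om : R).

Definition chain_function (a0 : R) (u : chain_vertex) : R :=
  match u with
  | inl _ => a0
  | inr (inl (b, o)) => by_level (al b) (be b) (ga b) o
  | inr (inr _) => om
  end.

Lemma sum_blocks b o : (b < k)%N -> (o <= d)%N ->
  \sum_(b' < k) \sum_(o' < d.+1) (blocks b o b' o')%:R * by_level (al b') (be b') (ga b') o' =
  by_level ((d - p)%:R * be b) (al b + (d - p)%:R * be b + p%:R * ga b - be b)
    ((d - p)%:R * be b + p%:R * ga b - ga b) o
  + (if (b.+1 < k)%N then (top o)%:R * al b.+1 else 0)
  + (if (0 < b)%N then (o == 0%N)%:R * (p%:R * ga b.-1) else 0).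
Proof.
move=> bk od.
pose G b' o' := by_level (al b') (be b') (ga b') o'.
have split3 b' : \sum_(o' < d.+1) (blocks b o b' o')%:R * G b' o' =
    (if b' == b then \sum_(o' < d.+1) (inner o o')%:R * G b' o' else 0)
    + (if b' == b.+1 then (top o)%:R * al b' else 0)
    + (if b == b'.+1 then (o == 0%N)%:R * (p%:R * ga b') else 0).
  have [e0|n0] := eqVneq b' b.
    rewrite e0 (_ : (b == b.+1) = false) ?addr0; last by lia.
    by apply: eq_bigr => o' _; rewrite /blocks eqxx /= (_ : (b == b.+1) = false) ?orbF //; lia.
  rewrite add0r; have [e1|n1] := eqVneq b' b.+1.
    rewrite e1 (_ : (b == b.+2) = false) ?addr0; last by lia.
    rewrite -[RHS](_ : \sum_(o' < d.+1) (if o' == 0%N :> nat then (top o)%:R * G b.+1 o' else 0) = _).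
      apply: eq_bigr => o' _; rewrite /blocks eqxx /=.
      rewrite (_ : (b.+1 == b) = false) 1?(_ : (b == b.+2) = false); [|lia|lia].
      by rewrite /= orbF; case: eqP => _; rewrite ?andbT // andbF mul0r.
    by rewrite (sum_pick _ 0 (fun o' => (top o)%:R * G b.+1 o')) /G /by_level eqxx.
  rewrite add0r; have [e2|n2] := eqVneq b b'.+1.
    rewrite (eq_bigr (fun o' : 'I_d.+1 => (o == 0%N)%:R * by_level 0 0 (ga b') o')).
      by rewrite -mulr_sumr sum_by_level mulr0 !add0r.
    move=> o' _; rewrite /blocks (negPf n0) (negPf n1) e2 eqxx /= /G /by_level /top.
    case: (o == 0%N); rewrite ?andbT ?andbF ?mul0r // !mul1r.
    case: eqP => [->|_]; first by rewrite (_ : (d - p < 0)%N = false) ?mul0r //; lia.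
    by case: ifP; rewrite ?mul0r ?mul1r.
  by apply: big1 => o' _; rewrite /blocks (negPf n0) (negPf n1) (negPf n2) mul0r.
under eq_bigr do rewrite split3.
rewrite !big_split /= (sum_pick k b (fun b' => \sum_(o' < d.+1) (inner o o')%:R * G b' o')).
rewrite (sum_pick k b.+1 (fun b' => (top o)%:R * al b')).
rewrite bk sum_inner //; congr (_ + _ + _).
case: b bk split3 => [|b] bk _ /=; first by apply: big1.
rewrite (eq_bigr (fun i : 'I_k => if i == b :> nat then (o == 0%N)%:R * (p%:R * ga i) else 0)).
  by rewrite (sum_pick k b (fun i => (o == 0%N)%:R * (p%:R * ga i))) (ltnW bk).
by move=> i _; rewrite eqSS eq_sym.
Qed.

Lemma sum_edge_block a0 (b : 'I_k) (o : 'I_d.+1) :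
  \sum_v (chain_edge (inr (inl (b, o))) v)%:R * chain_function a0 v =
  ((b == 0%N :> nat) && (o == 0%N :> nat))%:R * a0
  + (by_level ((d - p)%:R * be b) (al b + (d - p)%:R * be b + p%:R * ga b - be b)
      ((d - p)%:R * be b + p%:R * ga b - ga b) o
    + (if (b.+1 < k)%N then (top o)%:R * al b.+1 else 0)
    + (if (0 < b)%N then (o == 0%N :> nat)%:R * (p%:R * ga b.-1) else 0)
    + (if b.+1 == k then (top o)%:R * om else 0)).
Proof.
rewrite sum_chain /=; congr (_ + (_ + _)).
- pose c := ((b == 0%N :> nat) && (o == 0%N :> nat))%:R * a0.
  rewrite (eq_bigr (fun i : 'I_r => if i == r.-1 :> nat then c else 0)).
    by rewrite (sum_pick r r.-1 (fun=> c)) ifT //; lia.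
  move=> i _; rewrite /entry /c (_ : (i.+1 == r) = (i == r.-1 :> nat)); last by lia.
  by case: (_ == r.-1); rewrite ?mul0r.
- by apply: sum_blocks; [exact: ltn_ord | rewrite -ltnS ltn_ord].
- rewrite (eq_bigr (fun t : 'I_T => if t == (o - (d - p).+1)%N :> nat then
    (if b.+1 == k then (top o)%:R * om else 0) else 0)).
    rewrite (sum_pick T (o - (d - p).+1)%N (fun=> if b.+1 == k then (top o)%:R * om else 0)).
    by rewrite ifT //; have := ltn_ord o; lia.
  move=> t _; rewrite /port; have ok := ltn_ord o.
  case: (b.+1 == k) => /=; last by rewrite mul0r if_same.
  have [to|nto] := boolP (top o); last first.
    rewrite (_ : (_ && _) = false) ?mul0r ?if_same //.
    by move: nto; rewrite /top; lia.
  rewrite (_ : (_ && _) = (t == o - (d - p).+1 :> nat)%N).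
    by case: ifP => _; rewrite ?mul1r ?mul0r.
  by move: to; rewrite /top => to; apply/idP/idP; lia.
Qed.

Lemma sum_edge_cap a0 (t : 'I_T) :
  \sum_v (chain_edge (inr (inr t)) v)%:R * chain_function a0 v =
  (if (t < p)%N then ga k.-1 else 0) + (d - (t < p))%:R * om.
Proof.
rewrite sum_chain /= big1 ?add0r => [|i _]; last by rewrite mul0r.
congr (_ + _).
  pose H b := if (t < p)%N then by_level (al b) (be b) (ga b) ((d - p).+1 + t)%N else 0.
  rewrite (eq_bigr (fun b : 'I_k => if b == k.-1 :> nat then H b else 0)).
    rewrite (sum_pick k k.-1 H) ifT /H; last by lia.
    case: ifP => // _.
    by rewrite /by_level /top /= ifT //; lia.
  move=> b _; rewrite /port (_ : (b.+1 == k) = (b == k.-1 :> nat)); last by lia.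
  case: (_ == k.-1) => /=; last by apply: big1 => o _; rewrite mul0r.
  rewrite /H; case: (ltnP t p) => tp; last by apply: big1 => o _; rewrite andbF mul0r.
  rewrite (eq_bigr (fun o : 'I_d.+1 => if o == ((d - p).+1 + t)%N :> nat then
      by_level (al b) (be b) (ga b) o else 0)).
    by rewrite (sum_pick d.+1 ((d - p).+1 + t)%N (by_level (al b) (be b) (ga b))) ifT //; lia.
  by move=> o _; rewrite andbT; case: (_ == _); rewrite ?mul1r ?mul0r.
rewrite -mulr_suml -natr_sum; congr (_%:R * _).
by rewrite -[X in (X - _)%N](cap_deg (ltn_ord t)) big_mkord addnK.
Qed.

End EdgeSums.

Section TestVector.
Variables (s g : nat -> R) (mu : R).
Hypotheses (mu_ge0 : 0 <= mu) (s_0 : s 0%N = 0) (s_ge0 : forall b, (b <= k)%N -> 0 <= s b).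
Hypotheses (g_ge0 : forall b, (b < k)%N -> 0 <= g b).
Hypothesis s_step : forall b, (b < k)%N -> s b.+1 = s b + d.+1%:R * g b.
Hypothesis g_step : forall b, (b.+1 < k)%N -> g b - g b.+1 = mu * s b.+1.
Hypothesis g_last : g k.-1 = mu * s k.

(* Inside a block the function is the harmonic interpolation between the values at the
   first vertices of this block and of the next one. *)
Let x := chain_function s (fun b => s b + p%:R * g b)
  (fun b => s b + p.+1%:R * g b) (s k) 0.

Let Pge0 : 0 <= p%:R :> R. Proof. exact: ler0n. Qed.
Let Dge : p%:R <= d%:R :> R. Proof. by rewrite ler_nat ltnW. Qed.

(** From one first vertex to the next, the values rise by [p g], [g] and [(d - p) g], which makes
    the function harmonic in between. At offset 0 the Laplacian is [p (d - p) (g b.-1 - g b)]; in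
    block 0, where the path is attached, the factor [s 0 = 0] removes it. *)
Lemma chain_energy_block (b : 'I_k) (o : 'I_d.+1) :
  x (inr (inl (b, o))) * (d%:R * x (inr (inl (b, o))) -
    \sum_v (chain_edge (inr (inl (b, o))) v)%:R * x v) =
  (if o == 0%N :> nat then p%:R * (d%:R - p%:R) * mu * s b ^+ 2 else 0).
Proof.
rewrite /x sum_edge_block /=; have bk := ltn_ord b.
have sS := s_step bk; rewrite !natrB ?(ltnW pd) //.
rewrite /by_level; have [ o0|o0] := eqVneq (o : nat) 0%N.
  rewrite andbT /top o0 ltn0 !mul0r !if_same !addr0 mulr0 add0r mul1r.
  case: ifP => b0; last by rewrite (_ : b = 0%N :> nat) ?s_0; [lra|lia].
  have b1k : (b.-1.+1 < k)%N by rewrite prednK.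
  have := g_step b1k; have := s_step (ltnW b1k); rewrite prednK // => -> h.
  have gb : g b = g b.-1 - mu * (s b.-1 + d.+1%:R * g b.-1) by lra.
  by rewrite gb -!natr1; lra.
rewrite andbF mul0r !mul0r if_same addr0 add0r.
have [to|nto] := boolP (top o).
  rewrite !mul1r -natr1; case: ltnP => bk1.
    by rewrite ifF ?sS -?natr1; [lra|lia].
  have e : b.+1 = k by lia.
  have {}sS : s k = s b + d.+1%:R * g b by rewrite -sS e.
  by rewrite ifT ?sS -?natr1; [lra|lia].
by rewrite !mul0r !if_same -natr1; lra.
Qed.

Lemma chain_energy_cap (t : 'I_T) :
  x (inr (inr t)) * (d%:R * x (inr (inr t)) -
    \sum_v (chain_edge (inr (inr t)) v)%:R * x v) =
  (if (t < p)%N then (d%:R - p%:R) * mu * s k ^+ 2 else 0).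
Proof.
rewrite /x sum_edge_cap /= g_last.
have k1k : (k.-1 < k)%N by lia.
have := s_step k1k; rewrite prednK // g_last => h.
have h2 : s k.-1 = s k - d.+1%:R * (mu * s k) by lra.
rewrite h2; case: ifP => tp; last by rewrite subn0; lra.
by rewrite natrB ?(leq_trans _ d3) // -!natr1; lra.
Qed.

Lemma chain_rayleigh :
  (d%:R - p%:R * (d%:R - p%:R) * mu / d.+1%:R) * \sum_u x u * x u <=
  \sum_u x u * \sum_v (chain_edge u v)%:R * x v.
Proof.
pose S := \sum_(b < k) s b ^+ 2 + s k ^+ 2.
have energy : \sum_u x u * (d%:R * x u - \sum_v (chain_edge u v)%:R * x v) =
    p%:R * (d%:R - p%:R) * mu * S.
  rewrite sum_chain big1 => [|i _]; last by rewrite mul0r.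
  under eq_bigr do (under eq_bigr do rewrite chain_energy_block).
  under [X in _ + (_ + X)]eq_bigr do rewrite chain_energy_cap.
  rewrite add0r /S [RHS](mulrDr (p%:R * (d%:R - p%:R) * mu)) mulr_sumr; congr (_ + _).
    by apply: eq_bigr => b _; rewrite (sum_pick d.+1 0 (fun=> p%:R * (d%:R - p%:R) * mu * s b ^+ 2)).
  rewrite -(big_mkord xpredT (fun t => if (t < p)%N then (d%:R - p%:R) * mu * s k ^+ 2 else 0)).
  rewrite (@big_cat_nat _ _ _ p) //=; last by lia.
  rewrite [X in _ + X]big_nat_cond [X in _ + X]big1 ?addr0; last first.
    by move=> i /andP[/andP[pi _] _]; rewrite ltnNge pi.
  rewrite (@eq_big_nat _ _ _ _ _ _ (fun=> (d%:R - p%:R) * mu * s k ^+ 2)).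
    by rewrite sumr_const_nat subn0 -[LHS]mulr_natl !mulrA.
  by move=> i /andP[_ ->].
(* A block has [d + 1] vertices of value at least [s b], and the cap has more than [d] vertices of
   value [s k]. *)
have mass : d.+1%:R * S <= \sum_u x u * x u.
  rewrite sum_chain big1 ?add0r => [|i _]; last by rewrite mul0r.
  rewrite /S (mulrDr d.+1%:R) mulr_sumr; apply: lerD.
    apply: ler_sum => b _; rewrite -[X in X%:R](card_ord d.+1) mulr_natl.
    rewrite -sumr_const; apply: ler_sum => o _.
    have sb := s_ge0 (ltnW (ltn_ord b)); have gb := g_ge0 (ltn_ord b).
    rewrite /x /= -expr2 ler_pXn2r ?nnegrE //.
      by rewrite /by_level; do 2 case: ifP => _ //; rewrite lerDl mulr_ge0.
    by rewrite /by_level; do 2 case: ifP => _ //; rewrite addr_ge0 // mulr_ge0.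
  by rewrite /x /= sumr_const card_ord -expr2 -[X in _ <= X]mulr_natl ler_wpM2r ?sqr_ge0 // ler_nat.
move: energy; under eq_bigr do rewrite mulrBr mulrCA.
rewrite sumrB -mulr_sumr => energy.
have c0 : 0 <= p%:R * (d%:R - p%:R) * mu by rewrite !mulr_ge0 // subr_ge0.
have : p%:R * (d%:R - p%:R) * mu * S <=
    p%:R * (d%:R - p%:R) * mu / d.+1%:R * \sum_u x u * x u.
  by rewrite -[X in _ <= X]mulrA ler_wpM2l // ler_pdivlMl ?ltr0n.
by rewrite -energy mulrBl !lerBlDl addrC.
Qed.
End TestVector.

(** Degrees are the neighbour sums of the constant function 1, so the edge sums above compute them
    too. *)
Lemma chain_degree (u : chain_vertex) : #|chain_edge u|%:R =
  \sum_v (chain_edge u v)%:R * chain_function (fun=> 1) (fun=> 1) (fun=> 1) 1 1 v :> R.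
Proof.
rewrite -sum1_card natr_sum big_mkcond; apply: eq_bigr => v _.
rewrite (_ : (v \in chain_edge u) = chain_edge u v) // (_ : chain_function _ _ _ _ _ v = 1).
  by rewrite mulr1; case: (chain_edge u v).
by case: v => [|[[b o]|]] //=; rewrite /by_level !if_same.
Qed.

Lemma chain_degree_cap (t : 'I_T) : #|chain_edge (inr (inr t))| = d.
Proof.
apply: (mulrIn (oner_neq0 R)); rewrite chain_degree sum_edge_cap mulr1.
by case: ifP => tp; rewrite ?add0r ?subn0 // nat1r; congr (_%:R); lia.
Qed.

Lemma chain_degree_path (i : 'I_r) : (#|chain_edge (inl i)| <= (0 < i) + 2)%N.
Proof.
have pickn m a (F : nat -> nat) :
    (\sum_(j < m) (if j == a :> nat then F j else 0) <= F a)%N.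
  by rewrite (sum_pick (M := nat) m a F); case: ifP.
rewrite -sum1_card big_mkcond (sum_chain (M := nat)).
apply: (@leq_trans (((0 < i) + 1) + (1 + 0))%N); last by rewrite addn0 -addnA.
apply: leq_add; last apply: leq_add.
- apply: leq_trans (_ : _ <= \sum_(j < r) ((if j == i.-1 :> nat then (0 < i) : nat else 0) +
    (if j == i.+1 :> nat then 1 else 0)))%N _.
    apply: leq_sum => j _; rewrite (_ : (_ \in _) = step i j) // /step.
    case: (eqVneq (j : nat) i.+1) => [_|_] /=; first by rewrite addn1.
    by case: eqP => // h; rewrite ifT; lia.
  rewrite big_split /=; apply: leq_add; first exact: (pickn _ _ (fun=> (0 < i) : nat)).
  exact: (pickn _ _ (fun=> 1%N)).
- apply: leq_trans (_ : _ <= \sum_(b < k) (if b == 0%N :> nat then 1 else 0))%N _; last first.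
    exact: (pickn _ _ (fun=> 1%N)).
  apply: leq_sum => b _.
  apply: leq_trans (_ : _ <= \sum_(o < d.+1) (if o == 0%N :> nat then (b == 0%N :> nat) : nat else 0))%N _.
    apply: leq_sum => o _; rewrite (_ : (_ \in _) = entry i b o) // /entry.
    by case: (o == 0%N :> nat); case: (b == 0%N :> nat); case: (i.+1 == r).
  by apply: leq_trans (pickn _ _ (fun=> (b == 0%N :> nat) : nat)) _; case: (b == 0%N :> nat).
- by rewrite big1.
Qed.

Lemma chain_degree_le (u : chain_vertex) : (#|chain_edge u| <= d)%N.
Proof.
case: u => [i|[[b o]|t]]; last by rewrite chain_degree_cap.
  by apply: leq_trans (chain_degree_path i) _; case: ltnP => _; lia.
rewrite -(ler_nat R) chain_degree sum_edge_block.
rewrite natrB ?(ltnW pd) // /by_level.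
have [ o0|o0] := eqVneq (o : nat) 0%N.
  rewrite andbT /top o0 ltn0 !mul0r !if_same !addr0.
  have p1 : 1 <= p%:R :> R by rewrite ler1n.
  by case: (posnP b) => b0; rewrite ?b0 ?eqxx ?(gtn_eqF b0) ?b0 /= ?mul0r ?mul1r; lra.
rewrite andbF mul0r !mul0r if_same addr0 add0r.
have bk := ltn_ord b.
have [to|nto] := boolP (top o).
  by rewrite !mul1r; case: ltnP => bk1; [rewrite ifF|rewrite ifT]; (lia || lra).
by rewrite !mul0r !if_same; lra.
Qed.

End Chain.

(** * The chain as a nonregular graph with a large eigenvalue *)

Lemma finite_graph_eigenvalue (R : realType) (V : finType) (E : rel V) (d n : nat)
    (x : V -> R) (r : R) :
  #|V| = n -> symmetric E -> irreflexive E -> (forall u v, connect E u v) ->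
  (forall u, #|E u| <= d)%N -> (exists u, #|E u| = d) -> (exists u, #|E u| < d)%N ->
  (exists u, x u != 0) ->
  r * (\sum_u x u * x u) <= \sum_u x u * \sum_v (E u v)%:R * x v ->
  exists2 e : rel 'I_n, nonregular_family d e &
    exists2 a, r <= a & eigenvalue (adjacency_matrix R e) a.
Proof.
move=> <- Esym Eirr Econn degle [u degu] [v degv] [w xw] ray.
pose e : rel 'I_#|V| := fun i j => E (enum_val i) (enum_val j).
have deg_e i : degree e i = #|E (enum_val i)|.
  rewrite degreeE -sum1_card [RHS]big_mkcond [RHS](reindex (fun i : 'I_#|V| => enum_val i)) /=; last first.
    by exists enum_rank => j _; rewrite ?enum_valK ?enum_rankK.
  by apply: eq_bigr => j _; rewrite (_ : (_ \in _) = e i j) //.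
exists e.
  split.
  - by split=> [i j|i]; [exact: Esym | exact: Eirr].
  - move=> i j; rewrite -(enum_valK i) -(enum_valK j).
    have /connectP[s] := Econn (enum_val i) (enum_val j).
    elim: s (enum_val i) => [|y s IH] z /=; first by move=> _ ->; exact: connect0.
    move=> /andP[zy ys] ej; apply: connect_trans (IH y ys ej).
    by apply: connect1; rewrite /e !enum_rankK.
  - move=> [c reg]; have := reg (enum_rank u); have := reg (enum_rank v).
    by rewrite !deg_e !enum_rankK degu => <- dv; move: degv; rewrite dv ltnn.
  - apply/eqP; rewrite eqn_leq; apply/andP; split.
      by apply/bigmax_leqP => i _; rewrite deg_e.
    rewrite -{1}degu -[u]enum_rankK -deg_e; exact: (leq_bigmax (enum_rank u)).
have sumE (F : V -> R) : \sum_u F u = \sum_(i < #|V|) F (enum_val i).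
  rewrite (reindex (fun i : 'I_#|V| => enum_val i)) //.
  by exists enum_rank => j _; rewrite ?enum_valK ?enum_rankK.
have A_sym : (adjacency_matrix R e)^T = adjacency_matrix R e.
  by apply/matrixP => i j; rewrite !mxE /e Esym.
pose z : 'rV[R]_#|V| := \row_i x (enum_val i).
apply: (rayleigh_eigenvalue A_sym (u := z)).
  by apply/rV0Pn; exists (enum_rank w); rewrite mxE enum_rankK.
have -> : \sum_(i < #|V|) z 0 i * z 0 i = \sum_u x u * x u.
  by rewrite sumE; apply: eq_bigr => i _; rewrite mxE.
have -> // : \sum_(i < #|V|) (z *m adjacency_matrix R e) 0 i * z 0 i =
    \sum_u x u * \sum_v (E u v)%:R * x v.
rewrite sumE; apply: eq_bigr => i _; rewrite sumE [RHS]mulrC.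
congr (_ * _); last by rewrite mxE.
rewrite mxE; apply: eq_bigr => j _; rewrite [z 0 j]mxE.
have -> : adjacency_matrix R e j i = (e j i)%:R by rewrite mxE.
by rewrite /e Esym mulrC.
Qed.

Lemma sin_two_step (R : realType) (t : R) (b : nat) :
  2 * sin (t * b.+1%:R) - sin (t * b%:R) - sin (t * b.+2%:R) =
  (2 - 2 * cos t) * sin (t * b.+1%:R).
Proof.
have -> : t * b%:R = t * b.+1%:R - t by rewrite -natr1; lra.
have -> : t * b.+2%:R = t * b.+1%:R + t by rewrite -natr1; lra.
rewrite sinB sinD; lra.
Qed.

Lemma chain_graph (R : realType) (d p r k T : nat) (cap : rel nat) :
  (2 < d)%N -> (0 < p < d)%N -> (0 < r)%N -> (0 < k)%N -> (d < T)%N ->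
  symmetric cap -> irreflexive cap ->
  (forall t, (t < T)%N -> (\sum_(0 <= t' < T) cap t t' + (t < p))%N = d) ->
  (forall t, (t < T)%N -> [\/ t = 0%N, cap 0%N t
    | exists2 t', (t' < T)%N & cap 0%N t' && cap t' t]) ->
  exists2 e : rel 'I_(r + (k * d.+1 + T)), nonregular_family d e &
    exists2 a : R, d%:R - p%:R * (d%:R - p%:R) * (pi / ((2 * k).+1 * d.+1)%:R) ^+ 2 <= a &
      eigenvalue (adjacency_matrix R e) a.
Proof.
move=> d3 /andP[p0 pd] r0 k0 Td cap_sym cap_irr cap_deg cap_conn.
(* For this angle [(k + 1) th = pi - k th], hence [s k.+1 = s k]: the slope vanishes at the cap, as
   [g_last] requires. *)
set th : R := pi / (2 * k).+1%:R.
have N0 : 0 < (2 * k).+1%:R :> R by rewrite ltr0n.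
have D0 : 0 < d.+1%:R :> R by rewrite ltr0n.
have thN : th * (2 * k).+1%:R = pi by rewrite divfK // gt_eqF.
have th0 : 0 < th by rewrite divr_gt0 ?pi_gt0.
have thk b : (b <= k)%N -> 0 <= th * b%:R <= pi / 2.
  move=> bk; rewrite mulr_ge0 ?ler0n ?ltW //=.
  have : th * b%:R <= th * k%:R by rewrite ler_pM2l // ler_nat.
  by move: thN; rewrite -natr1 natrM; lra.
pose s b := sin (th * b%:R) : R.
pose g b := (s b.+1 - s b) / d.+1%:R.
pose mu := (2 - 2 * cos th) / d.+1%:R.
have mu_ge0 : 0 <= mu by apply: divr_ge0; [|exact: ltW]; have := cos_le1 th; lra.
have s_0 : s 0%N = 0 by rewrite /s mulr0 sin0.
have s_ge0 b : (b <= k)%N -> 0 <= s b.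
  move=> /thk /andP[h1 h2]; apply: sin_ge0_pi; rewrite h1 /=; have := @pi_gt0 R; lra.
have g_ge0 b : (b < k)%N -> 0 <= g b.
  move=> bk; apply: divr_ge0; last exact: ltW.
  rewrite subr_ge0; have /andP[_ h2] := thk _ bk.
  have /andP[h1 _] := thk _ (ltnW bk).
  apply: le_sin => //; first by have := @pi_gt0 R; lra.
  by rewrite ler_pM2l // ler_nat.
have s_step b : (b < k)%N -> s b.+1 = s b + d.+1%:R * g b.
  by move=> _; rewrite /g mulrC divfK ?gt_eqF //; lra.
have g_step b : g b - g b.+1 = mu * s b.+1.
  rewrite /g /mu -mulrBl mulrAC; congr (_ * _).
  by rewrite -sin_two_step /s; lra.
have g_last : g k.-1 = mu * s k.
  have := g_step k.-1; rewrite prednK // => <-.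
  have -> : g k = 0; last by rewrite subr0.
  rewrite /g /s.
  have -> : th * k.+1%:R = pi - th * k%:R by rewrite -thN -!natr1 natrM; lra.
  by rewrite sinB sinpi cospi mul0r sub0r mulN1r opprK subrr mul0r.
have ray := chain_rayleigh d3 p0 pd r0 k0 Td cap_deg mu_ge0 s_0 s_ge0 g_ge0 s_step
  (fun b _ => g_step b) g_last.
have sk : s k != 0.
  rewrite gt_eqF //; apply: sin_gt0_pi; have /andP[_ h2] := thk k (leqnn _).
  by rewrite mulr_gt0 ?ltr0n //=; have := @pi_gt0 R; lra.
have T0 : (0 < T)%N by lia.
have conn := chain_connect d3 p0 pd r0 k0 Td cap_conn.
have [ | | | | | |e fam [a ra ea]] := finite_graph_eigenvalue (d := d)
  (n := r + (k * d.+1 + T)) _ (chain_edge_sym p cap_sym)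
  (chain_edge_irr d3 p0 pd r0 k0 Td cap_irr) _ _ _ _ _ ray.
- by rewrite !card_sum card_prod !card_ord.
- move=> u v; apply: connect_trans (conn v).
  by rewrite (sym_connect_sym (chain_edge_sym p cap_sym)).
- exact: (chain_degree_le R d3 p0 pd r0 k0 Td cap_deg).
- exists (inr (inr (Ordinal T0))).
  exact: (chain_degree_cap R d3 p0 pd r0 k0 Td cap_deg).
- exists (inl (Ordinal r0)).
  by apply: leq_ltn_trans (chain_degree_path cap d3 p0 pd r0 k0 Td (Ordinal r0)) _.
- by exists (inr (inr (Ordinal T0))).
exists e => //; exists a => //; apply: le_trans ra.
rewrite lerD2l lerN2 -mulrA ler_wpM2l //.
  by rewrite mulr_ge0 // subr_ge0 ler_nat ltnW.
rewrite /mu natrM invfM mulrA -/th exprMn (expr2 d.+1%:R^-1) mulrA.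
rewrite ler_wpM2r ?invr_ge0 ?(ltW D0) // ler_wpM2r ?invr_ge0 ?(ltW D0) //.
have := cos_ge (ltW th0); lra.
Qed.

(* The complement of the graph with edges {t, m t}, which consists of the edge 01 for
   [even_mate], and of the path 1-0-2 and the matching 34, 56, ... for [odd_mate]. *)
Definition mate_cap (m : nat -> nat) : rel nat :=
  fun t t' => [&& t != t', t' != m t & t != m t'].
Definition even_mate t := if (t < 2)%N then (1 - t)%N else t.
Definition odd_mate t :=
  if t == 0%N then 1%N else if (t < 3)%N then 0%N else if odd t then t.+1 else t.-1.

Lemma mate_cap_sym m : symmetric (mate_cap m).
Proof. by move=> t t'; rewrite /mate_cap eq_sym [X in _ && X]andbC. Qed.

Lemma mate_cap_irr m : irreflexive (mate_cap m).
Proof. by move=> t; rewrite /mate_cap eqxx. Qed.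

Lemma sum_eq_nat T a : (a < T)%N -> (\sum_(0 <= t < T) (t == a) = 1)%N.
Proof.
move=> aT; rewrite big_mkord (bigD1 (Ordinal aT)) //= eqxx big1 // => i.
by rewrite -val_eqE /= => /negPf ->.
Qed.

Lemma even_cap_deg d t : (1 < d)%N -> (t < d.+1)%N ->
  (\sum_(0 <= t' < d.+1) mate_cap even_mate t t' + (t < 2) = d)%N.
Proof.
move=> d1 td; have : (\sum_(0 <= t' < d.+1) (mate_cap even_mate t t' + (t' == t) +
    (if t < 2 then t' == (1 - t)%N : nat else 0)) = \sum_(0 <= t' < d.+1) 1)%N.
  apply: eq_bigr => t' _; rewrite /mate_cap /even_mate.
  by case: t td => [|[|t]] td; case: t' => [|[|t']] //=; rewrite [t'.+2 == _]eq_sym; case: eqP.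
rewrite !big_split /= sum_eq_nat // sum_nat_const_nat muln1 subn0.
case: ltnP => t2; last by rewrite big1_eq; lia.
by rewrite sum_eq_nat; lia.
Qed.

Lemma even_cap_conn d t : (1 < d)%N -> (t < d.+1)%N ->
  [\/ t = 0%N, mate_cap even_mate 0%N t |
    exists2 t', (t' < d.+1)%N & mate_cap even_mate 0%N t' && mate_cap even_mate t' t].
Proof.
move=> d1 td; case: t td => [|[|t]] td; first by constructor 1.
  by constructor 3; exists 2%N.
by constructor 2.
Qed.

Lemma odd_cap_deg d t : odd d -> (t < d.+2)%N ->
  (\sum_(0 <= t' < d.+2) mate_cap odd_mate t t' + (t < 1) = d)%N.
Proof.
(* Vertex 0 has a second nonneighbour, 2, besides its mate 1; each other vertex misses only its
   mate. *)
move=> od td; have : (\sum_(0 <= t' < d.+2) (mate_cap odd_mate t t' + (t' == t) +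
    (t' == odd_mate t) + (if t == 0 then t' == 2 : nat else 0)) = \sum_(0 <= t' < d.+2) 1)%N.
  apply: eq_bigr => t' _; rewrite /mate_cap /odd_mate.
  case: t td => [|[|[|t]]] td /=; case: t' => [|[|[|t']]] //=;
    try first [by case: (odd t') | by case: (odd t)].
  - by case: (boolP (odd t')) => /=; lia.
  - by case: (boolP (odd t)) => /=; lia.
  by case: (boolP (odd t)); case: (boolP (odd t')) => /=; lia.
have mt : (odd_mate t < d.+2)%N.
  rewrite /odd_mate; case: eqP => // t0; case: (ltnP t 3) => // t3.
  case: ifP => ot; last by lia.
  have : t != d.+1 by apply: contraTneq ot => ->; rewrite /= od.
  by lia.
rewrite !big_split /= !sum_eq_nat // sum_nat_const_nat muln1 subn0.
case: eqP => t0; last by rewrite big1_eq; lia.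
by rewrite sum_eq_nat; lia.
Qed.

Lemma odd_cap_conn d t : (2 < d)%N -> (t < d.+2)%N ->
  [\/ t = 0%N, mate_cap odd_mate 0%N t |
    exists2 t', (t' < d.+2)%N & mate_cap odd_mate 0%N t' && mate_cap odd_mate t' t].
Proof.
move=> d2 td; case: t td => [|[|[|t]]] td; first by constructor 1.
- by constructor 3; exists 3%N; [lia|].
- by constructor 3; exists 3%N; [lia|].
- by constructor 2; rewrite /mate_cap /odd_mate /=; case: (odd t).
Qed.

(** * Asymptotics *)

(** The sign condition is for the empty set, whose [sup] is 0 by convention. *)
Lemma sup_le (R : realType) (A : set R) (x : R) : 0 <= x -> ubound A x -> sup A <= x.
Proof.
move=> x0 Ax; have [->|/set0P A0] := eqVneq A set0; first by rewrite sup0.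
exact: ge_sup.
Qed.

Lemma extremal_graph (R : realType) (d n : nat) : (2 < d)%N -> (2 * d + 4 <= n)%N ->
  exists2 e : rel 'I_n, nonregular_family d e &
    exists2 a : R, eigenvalue (adjacency_matrix R e) a &
      d%:R - a <= (if odd d then d - 1 else 2 * d - 4)%N%:R *
        (pi / (2 * n%:R - (3 * d + 5)%:R)) ^+ 2.
Proof.
move=> d3 dn; pose p := if odd d then 1%N else 2%N.
(* For odd [d] the degree sum [d T - 1] inside the cap must be even, which excludes [T = d + 1]. *)
pose T := if odd d then d.+2 else d.+1.
have p0d : (0 < p < d)%N by rewrite /p; case: (odd d); lia.
have Td : (d < T <= d.+2)%N by rewrite /T; case: (odd d); lia.
pose k := ((n - T - 1) %/ d.+1)%N; pose q := ((n - T - 1) %% d.+1)%N.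
have kq : (n - T - 1 = k * d.+1 + q)%N by exact: divn_eq.
have qd : (q < d.+1)%N by rewrite ltn_mod.
have k0 : (0 < k)%N by rewrite divn_gt0 //; lia.
have nE : n = (q.+1 + (k * d.+1 + T))%N by lia.
(* The path has at most [d + 1] vertices and the cap at most [d + 2]: twice their sum minus [d + 1]
   is [3 d + 5]. *)
have nk : (2 * n <= (2 * k).+1 * d.+1 + (3 * d + 5))%N by lia.
pose m := if odd d then odd_mate else even_mate.
have [ | |e fam [a ra ea]] := @chain_graph R d p q.+1 k T (mate_cap m) d3 p0d isT k0
    (proj1 (andP Td)) (mate_cap_sym m) (mate_cap_irr m).
- rewrite /T /p /m; case: (boolP (odd d)) => od t; first exact: odd_cap_deg.
  by apply: even_cap_deg; lia.
- rewrite /T /m; case: (odd d) => t; first exact: odd_cap_conn.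
  by apply: even_cap_conn; lia.
suff : exists2 e : rel 'I_(q.+1 + (k * d.+1 + T)), nonregular_family d e &
    exists2 a : R, eigenvalue (adjacency_matrix R e) a &
      d%:R - a <= (if odd d then d - 1 else 2 * d - 4)%N%:R *
        (pi / (2 * n%:R - (3 * d + 5)%:R)) ^+ 2 by rewrite -nE.
exists e => //; exists a => //.
have -> : (if odd d then d - 1 else 2 * d - 4)%N%:R = p%:R * (d%:R - p%:R) :> R.
  rewrite -natrB -?natrM; last by lia.
  by congr (_%:R); rewrite /p; case: (odd d) => /=; clear -d3; lia.
have le_c : d%:R - a <= p%:R * (d%:R - p%:R) * (pi / ((2 * k).+1 * d.+1)%:R) ^+ 2.
  by rewrite lerBlDr -lerBlDl.
apply: le_trans le_c _; rewrite ler_wpM2l //.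
  by rewrite mulr_ge0 // subr_ge0 ler_nat ltnW //; case/andP: p0d.
have pos : 0 < 2 * n%:R - (3 * d + 5)%:R :> R.
  by rewrite -natrM subr_gt0 ltr_nat; lia.
rewrite ler_pXn2r ?nnegrE ?divr_ge0 ?pi_ge0 ?(ltW pos) //.
rewrite ler_wpM2l ?pi_ge0 // lef_pV2 ?posrE ?ltr0n ?muln_gt0 //.
by rewrite lerBlDr -natrM -natrD ler_nat.
Qed.

(** The bound is at most [2 d (2 / n) ^ 2 = 8 d / n ^ 2], and this is below [1 / (2 n)] from
    [n = 16 d] on. *)
Lemma gap_bound_small (R : realType) (d n C : nat) : (2 < d)%N -> (16 * d <= n)%N ->
  (if odd d then d - 1 else 2 * d - 4)%N%:R * (2 * sin (pi / (4 * (n + C)%:R))) ^+ 2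
    <= (2 * n%:R)^-1 :> R.
Proof.
move=> d3 nd; set c : R := (_%:R); set h := pi / _.
have n1 : (0 < n)%N by lia.
have n0 : 0 < n%:R :> R by rewrite ltr0n.
have c0 : 0 <= c by exact: ler0n.
have c2d : c <= 2 * d%:R by rewrite /c -natrM ler_nat; case: (odd d); lia.
have nC : 0 < (n + C)%:R :> R by rewrite ltr0n addn_gt0 n1.
have h0 : 0 <= h by rewrite divr_ge0 ?pi_ge0 // mulr_ge0 // ltW.
have hn : h <= n%:R^-1.
  rewrite /h ler_pdivrMr ?mulr_gt0 // mulrC -ler_pdivrMr ?invr_gt0 // invrK.
  have : n%:R <= (n + C)%:R :> R by rewrite ler_nat leq_addr.
  by have := @pi_lt4 R; have := @pi_gt0 R; nra.
have sh : 0 <= sin h.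
  apply: sin_ge0_pi; rewrite h0 /= ler_pdivrMr ?mulr_gt0 // ler_peMr ?pi_ge0 //.
  by rewrite -natrM ler1n muln_gt0 addn_gt0 n1.
have sn : (2 * sin h) ^+ 2 <= (2 / n%:R) ^+ 2.
  rewrite ler_pXn2r ?nnegrE ?mulr_ge0 ?invr_ge0 ?(ltW n0) // ler_wpM2l //.
  exact: le_trans (sin_le h0) hn.
apply: le_trans (_ : _ <= 2 * d%:R * (2 / n%:R) ^+ 2) _.
  by rewrite ler_pM // sqr_ge0.
have dn : 16 * d%:R <= n%:R :> R by rewrite -natrM ler_nat.
rewrite invfM exprMn; set i := n%:R^-1.
have i0 : 0 < i by rewrite invr_gt0.
have ni : n%:R * i = 1 by rewrite mulfV ?gt_eqF.
have := ler_wpM2r (ltW i0) dn; rewrite ni => di.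
have -> : 2 * d%:R * (2 ^+ 2 * i ^+ 2) = 2^-1 * i * (16 * d%:R * i) by rewrite !expr2; lra.
by rewrite ler_piMr // mulr_ge0 ?invr_ge0 // ltW.
Qed.

Lemma family_eigenvalue_le (R : realType) (d : nat) : (2 < d)%N ->
  exists C : nat, forall n : nat, (16 * d <= n)%N ->
  forall (e : rel 'I_n) (a : R), nonregular_family d e ->
    eigenvalue (adjacency_matrix R e) a ->
    a <= d%:R - (if odd d then d - 1 else 2 * d - 4)%N%:R * (2 * sin (pi / (4 * (n + C)%:R))) ^+ 2.
Proof.
move=> d3; have [C hC] := eigenvalue_gap R d3; exists C => n nd e a fam ea.
rewrite lerBrDl -lerBrDr.
have n1 : (0 < n)%N by lia.
have n0 : 0 < n%:R :> R by rewrite ltr0n.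
have [small|big] := lerP (2 * (d%:R - a) * n%:R) 1; first exact: hC ea small.
apply: le_trans (gap_bound_small R C d3 nd) _.
by rewrite -[X in X <= _]mul1r ler_pdivrMr ?mulr_gt0 //; lra.
Qed.

Lemma rho_bounds (R : realType) (d : nat) : (2 < d)%N ->
  exists C : nat, forall n : nat, (16 * d <= n)%N ->
  (if odd d then d - 1 else 2 * d - 4)%N%:R * (2 * sin (pi / (4 * (n + C)%:R))) ^+ 2
    <= d%:R - rho R n d <=
  (if odd d then d - 1 else 2 * d - 4)%N%:R * (pi / (2 * n%:R - (3 * d + 5)%:R)) ^+ 2.
Proof.
move=> d3; have [C hC] := @family_eigenvalue_le R d d3; exists C => n nd.
set c : R := _%:R; set lo := c * _; set up := c * _.
have [ | e fam [a ea da]] := @extremal_graph R d n d3; first by lia.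
have spec (e' : rel 'I_n) : nonregular_family d e' ->
    ubound [set b : R | eigenvalue (adjacency_matrix R e') b] (d%:R - lo).
  by move=> fam' b; exact: hC.
have rad_ge (e' : rel 'I_n) b : nonregular_family d e' ->
    eigenvalue (adjacency_matrix R e') b -> b <= spectral_radius R e'.
  by move=> fam' eb; apply: ub_le_sup => //; exists (d%:R - lo); exact: spec.
have lo_d : 0 <= d%:R - lo.
  rewrite subr_ge0; apply: le_trans (gap_bound_small R C d3 nd) _.
  apply: (@le_trans _ _ 1); last by rewrite ler1n; lia.
  by rewrite invf_le1 ?mulr_gt0 ?ltr0n -?natrM ?ler1n; lia.
have rads : ubound [set spectral_radius R e' | e' in @nonregular_family n d] (d%:R - lo).
  by move=> _ [e' fam' <-]; apply: sup_le lo_d (spec _ fam').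
have rho_le : rho R n d <= d%:R - lo by exact: sup_le.
have rho_ge : a <= rho R n d.
  apply: le_trans (rad_ge e a fam ea) _; apply: ub_le_sup; last by exists e.
  by exists (d%:R - lo).
apply/andP; split; first by rewrite lerBrDl -lerBrDr.
by apply: le_trans da; rewrite lerD2l lerN2.
Qed.

Lemma gap_coefficientE (R : realType) d : (2 < d)%N ->
  (if odd d then d - 1 else 2 * d - 4)%N%:R = c_ R d.
Proof.
move=> d3; rewrite /c_; case: (odd d); first by rewrite natrB //; lia.
by rewrite natrB ?natrM ?mulrBr -?natrM //; lia.
Qed.

Lemma rho_expansion (R : realType) (d : nat) : (2 < d)%N ->
  exists M N : nat, forall n : nat, (N <= n)%N ->
  `| (d%:R - rho R n d) * (4 * n%:R ^+ 2 / pi ^+ 2) - c_ R d | <= M%:R / n%:R.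
Proof.
move=> d3; have [C hC] := @rho_bounds R d d3.
pose K := (3 * d + 5)%N; pose c := (if odd d then d - 1 else 2 * d - 4)%N.
exists (c * (2 * C.+1 + 3 * K))%N, (16 * d + C.+1 + K)%N => n nN.
have /hC/andP[lo up] : (16 * d <= n)%N by lia.
rewrite -gap_coefficientE // -/c; move: up; rewrite -/K -/c => up.
have n1 : (0 < n)%N by lia.
have n0 : 0 < n%:R :> R by rewrite ltr0n.
have p0 : 0 < pi :> R := pi_gt0 R.
have c0 : 0 <= c%:R :> R by exact: ler0n.
have scale (x : R) : (x * pi / (2 * n%:R)) ^+ 2 * (4 * n%:R ^+ 2 / pi ^+ 2) = x ^+ 2.
  have -> : 4 * n%:R ^+ 2 / pi ^+ 2 = (2 * n%:R / pi) ^+ 2 :> R.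
    by rewrite !exprMn exprVn -(natrX _ 2 2).
  by rewrite -exprMn mulrA divfK ?mulfK // ?mulf_neq0 ?gt_eqF.
set s := 4 * n%:R ^+ 2 / pi ^+ 2 in scale *.
have s0 : 0 <= s by apply: divr_ge0; [apply: mulr_ge0; rewrite ?sqr_ge0|exact: sqr_ge0].
have nK : K%:R <= n%:R :> R by rewrite ler_nat; lia.
have nC : C.+1%:R <= n%:R :> R by rewrite ler_nat; lia.
set i := n%:R^-1.
have i0 : 0 < i by rewrite invr_gt0.
have ni : n%:R * i = 1 by rewrite mulfV ?gt_eqF.
have Ki : K%:R * i <= 1 by have := ler_wpM2r (ltW i0) nK; rewrite ni.
have Ci : C.+1%:R * i <= 1 by have := ler_wpM2r (ltW i0) nC; rewrite ni.
rewrite natrM natrD !(natrM _ 2) !(natrM _ 3).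
have upper : (d%:R - rho R n d) * s <= c%:R * (1 + 3 * K%:R * i).
  apply: le_trans (ler_wpM2r s0 up) _; rewrite -[leLHS]mulrA ler_wpM2l //.
  have K0 : 0 < 2 * n%:R - K%:R :> R by lra.
  apply: (@le_trans _ _ (((1 + K%:R * i) * pi / (2 * n%:R)) ^+ 2 * s)).
    rewrite ler_wpM2r // ler_pXn2r ?nnegrE //.
    - rewrite ler_pdivrMr // mulrAC ler_pdivlMr ?mulr_gt0 //.
      rewrite [_ * pi]mulrC -mulrA ler_pM2l //.
      have Kn : K%:R * i * n%:R = K%:R by rewrite -mulrA [i * _]mulrC ni mulr1.
      by have := mulr_ge0 (ler0n R K) (_ : 0 <= 1 - K%:R * i); rewrite subr_ge0 Ki => /(_ isT); lra.
    - by rewrite divr_ge0 ?(ltW p0) ?(ltW K0).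
    - by rewrite divr_ge0 ?mulr_ge0 ?(addr_ge0 ler01) ?(ltW p0) ?(ltW n0) ?mulr_ge0 ?(ltW i0).
  rewrite scale; have : 0 <= K%:R * i by rewrite mulr_ge0 // ltW.
  rewrite -mulrA; move: Ki; set u := K%:R * i; rewrite expr2; nra.
have lower : c%:R * (1 - 2 * C.+1%:R * i) <= (d%:R - rho R n d) * s.
  apply: le_trans (ler_wpM2r s0 lo); rewrite -[leRHS]mulrA ler_wpM2l //.
  apply: (@le_trans _ _ (((1 - C.+1%:R * i) * pi / (2 * n%:R)) ^+ 2 * s)).
    by rewrite scale expr2; have := sqr_ge0 (C.+1%:R * i); rewrite expr2; lra.
  (* Replacing [n + C] by [n] costs the relative error [C / n]; the cubic term of the sine costs at
     most one more [1 / n]. *)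
  have sine : (1 - C.+1%:R * i) * pi / (2 * n%:R) <= 2 * sin (pi / (4 * (n + C)%:R)) :> R.
    have m0 : 0 < (n + C)%:R :> R by rewrite ltr0n addn_gt0 n1.
    rewrite invfM [in leRHS]invfM -/i; set j := (n + C)%:R^-1.
    have mj : (n + C)%:R * j = 1 by rewrite mulfV ?gt_eqF.
    have j0 : 0 < j by rewrite invr_gt0.
    have ji : j <= i by rewrite lef_pV2 ?posrE // ler_nat leq_addr.
    have j1 : j <= 1 by rewrite invf_le1 // ler1n addn_gt0 n1.
    have ij : i = j + C%:R * i * j.
      have nij : n%:R * i * j = j by rewrite ni mul1r.
      by have := congr1 ( *%R i) mj; rewrite natrD; lra.
    set h := pi * _; have hE : h = pi / 4 * j by rewrite /h mulrA.
    have h0 : 0 <= h by rewrite hE mulr_ge0 ?divr_ge0 ?(ltW p0) ?(ltW j0).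
    have hj : h <= j by rewrite hE ler_piMl ?(ltW j0) //; have := @pi_lt4 R; lra.
    have := sin_ge h0.
    have hh : h ^+ 2 <= j.
      apply: (@le_trans _ _ (j ^+ 2)); first by rewrite ler_pXn2r ?nnegrE ?(ltW j0).
      by rewrite expr2 ler_piMl ?(ltW j0).
    have : h * (1 - j) <= h * (1 - h ^+ 2 / 2) by rewrite ler_wpM2l //; lra.
    have ij2 : i * (1 - C.+1%:R * i) <= j * (1 - j).
      have Cij : C%:R * i * j <= C%:R * i * i by rewrite ler_wpM2l // mulr_ge0 // ltW.
      have jj : j * j <= i * i by rewrite ler_pM // ltW.
      by rewrite -natr1; lra.
    have : pi / 4 * (i * (1 - C.+1%:R * i)) <= pi / 4 * (j * (1 - j)).
      by rewrite ler_wpM2l // divr_ge0 // ltW.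
    by rewrite hE; lra.
  rewrite ler_wpM2r // ler_pXn2r ?nnegrE //.
    by rewrite divr_ge0 ?mulr_ge0 ?subr_ge0 ?(ltW p0) ?(ltW n0).
  apply: le_trans sine.
  by rewrite divr_ge0 ?mulr_ge0 ?subr_ge0 ?(ltW p0) ?(ltW n0).
have cK : 0 <= c%:R * K%:R * i by rewrite !mulr_ge0 // ltW.
have cC : 0 <= c%:R * C.+1%:R * i by rewrite !mulr_ge0 // ltW.
by rewrite ler_norml; apply/andP; split; lra.
Qed.

Theorem theorem1p7 (R : realType) (d : nat) (hd : (3 <= d)%N) :
  exists eps : nat -> R,
    (eps n @[n --> \oo] --> (0 : R)) /\
    (forall n : nat, (d.+1 <= n)%N ->
       d%:R - rho R n d = (c_ R d + eps n) * (pi ^+ 2 / (4 * n%:R ^+ 2))).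
Proof.
have [M [N eps_le]] := @rho_expansion R d hd.
pose eps n : R := (d%:R - rho R n d) * (4 * n%:R ^+ 2 / pi ^+ 2) - c_ R d.
exists eps; split; last first.
  move=> n dn; rewrite /eps [c_ R d + _]addrC subrK -[pi ^+ 2 / _]invf_div mulfK //.
  by rewrite gt_eqF // divr_gt0 ?exprn_gt0 ?pi_gt0 // mulr_gt0 ?exprn_gt0 ?ltr0n //; lia.
have harm (c : R) : (c * harmonic n) @[n --> \oo] --> (0 : R).
  rewrite -[X in _ --> X](mulr0 c); apply: cvgMr; exact: cvg_harmonic.
(* [harmonic n] is [1 / (n + 1)], hence the factor 2 to dominate [M / n]. *)
apply: (squeeze_cvgr _ (harm (- (2 * M%:R))) (harm (2 * M%:R))).
exists N.+1 => // n /= nN; rewrite mulNr -ler_norml.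
apply: le_trans (eps_le n (ltnW nN)) _; rewrite /harmonic [2 * _]mulrC -mulrA ler_wpM2l //.
have n0 : 0 < n%:R :> R by rewrite ltr0n; lia.
rewrite ler_pdivlMr ?ltr0n // mulrC ler_pdivrMr // -natrM ler_nat; lia.
Qed.
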